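(* (i) For fixed positive integers $l,m$, as $n\to\infty$: if $1\le m<l$, then $$\lim_{n\to\infty}P_n^{\text{park}}(\sigma^{-1}_{n-1}=n+1-l,\ \sigma^{-1}_n=n+1-m)=\frac{(l-m)^{l-m-1}m^{m-1}}{(l-m)!\,m!}e^{-l};$$ if $1\le l<m$, then $$P_n^{\text{park}}(\sigma^{-1}_{n-1}=n+1-l,\ \sigma^{-1}_n=n+1-m)\sim\frac{(m-l)^{m-l}\,l^{l-1}}{l!\,(m-l)!}\,e^{-m}\,\frac1n.$$ Thus, the random vector $(n+1-\sigma^{-1}_{n-1},\ n+1-\sigma^{-1}_n)$ under $P_n^{\text{park}}$ converges in distribution to a random vector $(X_1+X_2,X_2)$, where $X_1$ and $X_2$ are IID with the Borel distribution. (ii) For fixed positive integers $l,m$, as $n\to\infty$, $$P_n^{\text{park}}(\sigma^{-1}_{n-1}=l,\ \sigma^{-1}_n=m)\sim\begin{cases}\dfrac{l^l}{l!}\,\dfrac{(m-l)^{m-l-1}m}{(m-l)!}\,e^{-m}\,\dfrac1{n^2},&1\le l<m;\\[2mm] \dfrac{m^m}{m!}\,\dfrac{(l-m)^{l-m}}{(l-m)!}\,e^{-l}\,\dfrac1{n^2},&1\le m<l.\end{cases}$$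
   Context: $[n]=\{1,\dots,n\}$ and $S_n$ is the set of permutations $\sigma=\sigma_1\cdots\sigma_n$ of $[n]$; $\sigma^{-1}_k=j$ if and only if $\sigma_j=k$. Parking: cars $1,\dots,n$ arrive in this order on a one-way street with spaces $1,\dots,n$; given a sequence $\pi=(\pi_1,\dots,\pi_n)\in[n]^n$ of preferred spaces, car $i$ parks in space $\pi_i$ if it is free, and otherwise in the first free space with number greater than $\pi_i$, if one exists (if none exists the car exits the street). $\pi$ is a parking function on $[n]$ if all $n$ cars are able to park; $\mathcal{P}_n$ is the set of parking functions on $[n]$. The map $T_n:\mathcal{P}_n\to S_n$ is $T_n(\pi)=\sigma$, where $\sigma_j$ is the number of the car that parked in space $j$, $j\in[n]$. The probability measure $P_n^{\text{park}}$ on $S_n$ is $P_n^{\text{park}}(\sigma)=|T_n^{-1}(\{\sigma\})|/|\mathcal{P}_n|$. The Borel distribution is the probability distribution on $\{1,2,\dots\}$ giving mass $e^{-m}\frac{m^{m-1}}{m!}$ to $m$. $a_n\sim b_n$ means $a_n/b_n\to1$. *)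

(* Defs.v *)
From HB Require Import structures.
From mathcomp Require Import all_boot all_order all_algebra all_fingroup.
From mathcomp Require Import all_classical all_reals all_analysis.

Set Implicit Arguments.
Unset Strict Implicit.
Unset Printing Implicit Defensive.

Import Order.TTheory GRing.Theory Num.Theory.
Import numFieldNormedType.Exports.

Local Open Scope classical_set_scope.
Local Open Scope ring_scope.

(* Cars and spaces are both numbered from 0: the ordinal [i : 'I_n] stands for
   car (or space) [i + 1] of [{1, ..., n}]. A permutation [s : 'S_n] is the
   word [s_1 ... s_n], [s j] being the car in space [j]. *)

Section Parking.
Variable n : nat.
Implicit Types (pi : {ffun 'I_n -> 'I_n}) (occ : {ffun 'I_n -> option 'I_n}).

(* [enum 'I_n] is increasing, so [ohead] below is the first free space
   beyond [p]. *)
Definition landing occ (p : 'I_n) : option 'I_n :=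
  if occ p == None then Some p
  else ohead [seq j : 'I_n <- enum 'I_n | (p < j)%N & occ j == None].

Definition park_car pi occ (i : 'I_n) : {ffun 'I_n -> option 'I_n} :=
  if landing occ (pi i) is Some p
  then [ffun j => if j == p then Some i else occ j]
  else occ.

Definition parked pi : {ffun 'I_n -> option 'I_n} :=
  foldl (park_car pi) [ffun=> None] (enum 'I_n).

Definition parking_functions : {set {ffun 'I_n -> 'I_n}} :=
  [set pi | [forall i : 'I_n, exists j : 'I_n, parked pi j == Some i]].

(* Only meaningful on [parking_functions], see [parking_permP]. *)
Definition parking_perm pi : 'S_n :=
  odflt 1%g [pick s : 'S_n | [forall j, parked pi j == Some (s j)]].

Lemma parking_permP pi : pi \in parking_functions ->
  forall j, parked pi j = Some (parking_perm pi j).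
Proof.
rewrite inE => /forallP allP.
have ex i : exists j, parked pi j == Some i by apply/existsP.
pose g i := xchoose (ex i).
have gP i : parked pi (g i) = Some i by apply/eqP/(xchooseP (ex i)).
have g_inj : injective g.
  by move=> i i' eg; have := gP i; rewrite eg gP => -[].
pose s := (perm g_inj)^-1%g.
have sP j : parked pi j = Some (s j).
  by rewrite -gP -(permE g_inj) permKV.
rewrite /parking_perm; case: pickP => [t /forallP tP j|/(_ s)/forallP[]].
  exact/eqP.
by move=> j; rewrite sP.
Qed.

Lemma parking_functions_gt0 : (0 < #|parking_functions|)%N.
Proof.
apply/card_gt0P; exists [ffun i => i]; rewrite inE; apply/forallP => i.
apply/existsP; exists i; rewrite /parked.
suff H (r : seq 'I_n) occ : uniq r -> {in r, forall j, occ j = None} ->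
    forall j, foldl (park_car [ffun k => k]) occ r j
              = if j \in r then Some j else occ j.
  rewrite H ?mem_enum ?enum_uniq// => j _; exact: ffunE.
elim: r occ => [|k r IH] occ //= /andP[kr ur] occ0 j.
have -> : park_car [ffun k => k] occ k
    = [ffun j => if j == k then Some k else occ j].
  by rewrite /park_car /landing ffunE occ0 ?mem_head.
rewrite IH//.
  by rewrite ffunE in_cons; case: eqP => [->|_] //=; rewrite if_same.
move=> j' j'r; rewrite ffunE; case: eqP => [e|_].
  by move: kr; rewrite -e j'r.
by apply: occ0; rewrite in_cons j'r orbT.
Qed.

End Parking.

HB.instance Definition _ (T : finType) := isPointed.Build (perm_type T) 1%g.
HB.instance Definition _ (T : finType) :=
  @isMeasurable.Build default_measure_display (perm_type T)
    discrete_measurable discrete_measurable0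
    discrete_measurableC discrete_measurableU.

Definition park_pmf {R : realType} (n : nat) (s : 'S_n) : R :=
  #|[set pi in parking_functions n | parking_perm pi == s]|%:R
  / #|parking_functions n|%:R.

(* [park_pmf] extended to events, so that it is a probability measure for the
   discrete sigma-algebra on ['S_n]. *)
Definition park_prob (R : realType) (n : nat) (A : set 'S_n) : \bar R :=
  (\sum_(s \in A) (park_pmf s : R)%:E)%E.

Section ParkProb.
Variables (R : realType) (n : nat).

Let park_prob0 : park_prob R (set0 : set 'S_n) = 0%E.
Proof. by rewrite /park_prob fsbig_set0. Qed.

Lemma park_pmf_ge0 (s : 'S_n) : 0 <= park_pmf s :> R.
Proof. by rewrite /park_pmf divr_ge0. Qed.

Let park_prob_ge0 (A : set 'S_n) : (0 <= park_prob R A)%E.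
Proof.
by apply: fsume_ge0 => s _; rewrite lee_fin park_pmf_ge0.
Qed.

Let park_prob_sigma_additive : semi_sigma_additive (@park_prob R n).
Proof.
move=> F mF tF mUF; rewrite /park_prob.
apply: cvg_toP.
  apply: ereal_nondecreasing_is_cvgn => a b ab.
  by apply: lee_sum_nneg_natr => // k _ _; exact: park_prob_ge0.
transitivity (\sum_(0 <= i <oo) (\esum_(s in F i) (park_pmf s : R)%:E))%E.
  apply: eq_eseriesr => k _; rewrite esum_fset//= => s _.
  by rewrite lee_fin park_pmf_ge0.
rewrite -nneseries_sum_bigcup//=; last first.
  by move=> s; rewrite lee_fin park_pmf_ge0.
by rewrite esum_fset//= => s _; rewrite lee_fin park_pmf_ge0.
Qed.

HB.instance Definition _ := isMeasure.Build _ _ _ (@park_prob R n)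
  park_prob0 park_prob_ge0 park_prob_sigma_additive.

Let park_prob_setT : park_prob R [set: 'S_n] = 1%E.
Proof.
rewrite /park_prob (@fsbigE _ _ _ _ _ (enum 'S_n)) ?enum_uniq//; last first.
  by move=> s _; rewrite mem_enum.
rewrite (eq_bigl xpredT) ?big_enum//=; last by move=> s; rewrite in_setT.
rewrite sumEFin -mulr_suml -natr_sum; congr EFin.
under eq_bigr do rewrite -sum1dep_card.
rewrite -(partition_big (@parking_perm n) xpredT)// sum1dep_card.
rewrite (_ : #|_| = #|parking_functions n|); last first.
  by apply: eq_card => pi; rewrite inE.
by rewrite divff// pnatr_eq0 -lt0n parking_functions_gt0.
Qed.

HB.instance Definition _ :=
  @Measure_isProbability.Build _ _ R (@park_prob R n) park_prob_setT.

End ParkProb.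

(* The 1-based value s^-1_k, i.e. the number of the space where car k parked;
   the value 0 is a default for k outside [{1, ..., n}]. *)
Definition car_space (n : nat) (s : 'S_n) (k : nat) : nat :=
  if k is k'.+1 then oapp (fun i : 'I_n => (s^-1%g i).+1 : nat) 0%N (insub k')
  else 0%N.

Definition asymp_equiv {R : realType} (a b : R^nat) : Prop :=
  a n / b n @[n --> \oo] --> (1 : R).

(* To be used for [1 <= m] only. *)
Definition borel_pmf {R : realType} (m : nat) : R :=
  expR (- m%:R) * (m%:R ^+ (m - 1) / m`!%:R).

Section RandomVariables.
Variable R : realType.

Definition borel_law d (T : measurableType d) (P : probability T R)
    (X : {RV P >-> R}) : Prop :=
  forall A : set R, measurable A ->
    distribution P X A
    = (\sum_(1 <= m <oo) (borel_pmf m)%:E * \d_(m%:R : R) A)%E.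

Definition independent_RV d (T : measurableType d) (P : probability T R)
    (X Y : {RV P >-> R}) : Prop :=
  forall A B : set R, measurable A -> measurable B ->
    (P (X @^-1` A `&` Y @^-1` B) = P (X @^-1` A) * P (Y @^-1` B))%E.

(* The maps [Xn n] and [X] are meant to be measurable, with respect to a
   sigma-algebra on [V] containing the open sets. *)
Definition cvg_in_distribution (V : topologicalType)
    (dn : nat -> measure_display) (Tn : forall n, measurableType (dn n))
    (Pn : forall n, probability (Tn n) R) (Xn : forall n, Tn n -> V)
    d (T : measurableType d) (P : probability T R) (X : T -> V) : Prop :=
  forall f : V -> R, continuous f -> bounded_fun f ->
    ('E_(Pn n)[f \o Xn n] @[n --> \oo] --> 'E_P[f \o X])%E.

End RandomVariables.

(* Main.v *)
Require Import Defs.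
From HB Require Import structures.
From mathcomp Require Import all_boot all_order all_algebra all_fingroup.
From mathcomp Require Import all_classical all_reals all_analysis.
From mathcomp Require Import ring lra zify.

Set Implicit Arguments.
Unset Strict Implicit.
Unset Printing Implicit Defensive.

Import Order.TTheory GRing.Theory Num.Theory.
Import numFieldNormedType.Exports.

Local Open Scope classical_set_scope.
Local Open Scope ring_scope.

(** Park the first [n - 2] cars. Up to the order in which the cars arrive, the
    two spaces [x < y] that they leave free cut the street into three blocks
    which fill independently of one another, and a block of [s] spaces can be
    filled by [s] cars in [(s + 1) ^ (s - 1)] ways. Hence the number of ways to
    leave exactly [x] and [y] free is a multinomial coefficient times three such
    powers ([ways_two_gaps]). The next car parks in [x] for every preference up
    to [x], and in [y] for every preference after [x] and up to [y]; the last
    car then takes the remaining space for every preference up to that space.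
    This gives the joint law of the last two spaces exactly
    ([last_two_prob_lt], [last_two_prob_gt]).

    The counting is done on sets of occupied spaces. The last car to enter a
    set [O] parks at some [b] in [O], which yields a recursion for the number
    of ways to occupy [O] ([ways_rec]). With this recursion, independence of
    the two sides of a gap is Pascal's rule ([ways_setU]), and the count
    [(s + 1) ^ (s - 1)] for a block is Abel's binomial identity
    ([park_count_rec]).

    In all four regimes a single block is large, and what is left has a fixed
    size [c]. Its weight behaves as [expR (- c) / n ^ 2] ([cvg_big_block]), as
    [(1 - c / n) ^ n] tends to [expR (- c)], and the number of preferences of
    the last two cars contributes the remaining power of [n].

    For the convergence in distribution, the first limit is the product of two
    Borel masses, so it suffices that no mass escapes to infinity
    ([cvg_in_distribution_atoms]), that is, that the Borel weights sum to [1].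
    Their sum [s] is the extinction probability of a critical Poisson branching
    process and solves [s = expR (s - 1)], whose only root is [1]
    ([cvg_borel_sum]). The equation comes from the convolution powers of the
    Borel weights, which Hurwitz's form of Abel's identity computes
    ([borel_tanner_conv]), and from the binomial theorem, which resums them
    ([sum_borel_tanner_fact]). It is used through its truncations: one half
    bounds the partial sums by [1], the other one forces [s = 1]. *)

(** * Abel's binomial identity and the numbers (s + 1) ^ (s - 1) *)

Lemma alternating_sum_binS (R : comPzRingType) (n : nat) (f : nat -> R) :
  \sum_(k < n.+2) (-1) ^+ k * 'C(n.+1, k)%:R * f k
  = \sum_(k < n.+1) (-1) ^+ k * 'C(n, k)%:R * (f k - f k.+1).
Proof.
rewrite big_ord_recl /= bin0 !mul1r.
have -> : \sum_(i < n.+1) (-1) ^+ bump 0 i * 'C(n.+1, bump 0 i)%:R * f (bump 0 i)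
  = \sum_(i < n.+1) (-1) ^+ i.+1 * 'C(n, i.+1)%:R * f i.+1
    - \sum_(i < n.+1) (-1) ^+ i * 'C(n, i)%:R * f i.+1.
  rewrite -sumrB; apply: eq_bigr => i _; rewrite /bump add1n binS natrD exprS.
  by ring.
rewrite addrA.
have -> : f 0%N + \sum_(i < n.+1) (-1) ^+ i.+1 * 'C(n, i.+1)%:R * f i.+1
   = \sum_(i < n.+1) (-1) ^+ i * 'C(n, i)%:R * f i.
  rewrite big_ord_recr /= bin_small// mulr0 mul0r addr0.
  by rewrite [RHS]big_ord_recl /= bin0 expr0 !mul1r.
by rewrite -sumrB; apply: eq_bigr => i _; rewrite mulrBr.
Qed.

(** The [n]-th finite difference annihilates polynomials of degree [< n]:
    one difference step turns [(x + k) ^ r] into a combination of lower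
    powers. *)
Lemma finite_difference_exp (R : comPzRingType) (x : R) (n r : nat) : (r < n)%N ->
  \sum_(k < n.+1) (-1) ^+ k * 'C(n, k)%:R * (x + k%:R) ^+ r = 0.
Proof.
elim: n r => // n IHn r rn.
rewrite (alternating_sum_binS n (fun k => (x + k%:R) ^+ r)).
transitivity (- \sum_(i < r) ((\sum_(k < n.+1)
     (-1) ^+ k * 'C(n, k)%:R * (x + k%:R) ^+ i) * 'C(r, i)%:R)); last first.
  rewrite big1 ?oppr0// => i _; rewrite IHn ?mul0r//.
  by rewrite (leq_trans (ltn_ord i)).
under [in RHS]eq_bigr do rewrite mulr_suml.
rewrite exchange_big -sumrN; apply: eq_bigr => k _ /=.
under eq_bigr do rewrite -mulrA; rewrite -mulr_sumr -mulrN; congr (_ * _).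
rewrite -(addn1 k) natrD addrA (addrC _ 1) (exprDn 1) big_ord_recr /= subnn.
rewrite expr0 mul1r binn mulr1n opprD addrCA subrr addr0; congr (- _).
by apply: eq_bigr => i _; rewrite expr1n mul1r mulr_natr.
Qed.

Lemma bin_mul_binB (n k i : nat) : (i + k <= n)%N ->
  ('C(n, k) * 'C(n - k, i) = 'C(n, i) * 'C(n - i, k))%N.
Proof.
move=> ikn; have pos : (0 < k`! * i`! * (n - k - i)`!)%N by rewrite !muln_gt0 !fact_gt0.
apply/eqP; rewrite -(eqn_pmul2r pos); apply/eqP.
have h1 : ('C(n, k) * (k`! * (n - k)`!) = n`!)%N by apply: bin_fact; lia.
have h2 : ('C(n - k, i) * (i`! * (n - k - i)`!) = (n - k)`!)%N by apply: bin_fact; lia.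
have h3 : ('C(n, i) * (i`! * (n - i)`!) = n`!)%N by apply: bin_fact; lia.
have h4 : ('C(n - i, k) * (k`! * (n - k - i)`!) = (n - i)`!)%N.
  by rewrite -subnDA addnC subnDA; apply: bin_fact; lia.
transitivity n`!; first by rewrite -h1 -h2; ring.
by rewrite -h3 -h4; ring.
Qed.

(** Expanding [y + (n - k)] as [(x + y + n) - (x + k)] collects, in front of the
    power [i] of [x + y + n], an [(n - i)]-th finite difference of a polynomial
    of degree [n - i - 1]; only [i = n] survives. The factor [(x + k) ^ (k - 1)] is written as a
    quotient to cover [k = 0]. *)
Lemma abel_binomial (R : fieldType) (x y : R) (n : nat) :
  (forall k, x + k%:R != 0) ->
  \sum_(k < n.+1) 'C(n, k)%:R * (x * ((x + k%:R) ^+ k / (x + k%:R)))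
                  * (y + (n - k)%:R) ^+ (n - k)
  = (x + y + n%:R) ^+ n.
Proof.
move=> x0; set z := x + y + n%:R.
transitivity (\sum_(k < n.+1) \sum_(i < n.+1 | (i <= n - k)%N)
   'C(n, i)%:R * z ^+ i * x * (-1) ^+ (n - i) *
   ((-1) ^+ k * 'C(n - i, k)%:R * ((x + k%:R) ^+ (n - i) / (x + k%:R)))).
  apply: eq_bigr => k _; have kn : (k <= n)%N by rewrite -ltnS.
  have -> : y + (n - k)%:R = - (x + k%:R) + z.
    by rewrite /z natrB//; ring.
  rewrite (exprDn (- _)) (big_ord_widen n.+1 (fun i : nat =>
      (- (x + k%:R)) ^+ (n - k - i) * z ^+ i *+ 'C(n - k, i)));
    last by rewrite ltnS leq_subr.
  rewrite mulr_sumr; apply: eq_big => [i|i]; rewrite ?ltnS// => ink.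
  have -> : (x + k%:R) ^+ (n - i) = (x + k%:R) ^+ k * (x + k%:R) ^+ (n - k - i).
    by rewrite -exprD; congr (_ ^+ _); lia.
  have e : 'C(n, k)%:R * 'C(n - k, i)%:R = 'C(n, i)%:R * 'C(n - i, k)%:R :> R.
    by rewrite -!natrM bin_mul_binB//; lia.
  have -> : (-1) ^+ (n - i) = (-1) ^+ k * (-1) ^+ (n - k - i) :> R.
    by rewrite -exprD; congr (_ ^+ _); lia.
  have s2 : (-1) ^+ k * (-1) ^+ k = 1 :> R by rewrite -expr2 sqrr_sign.
  rewrite -mulr_natr (exprNn (x + _)); set q := (x + k%:R)^-1; set p := (x + k%:R) ^+ k.
  set w := (x + k%:R) ^+ _; move: s2 e; set s := (-1) ^+ k => s2 e.
  transitivity ('C(n, k)%:R * 'C(n - k, i)%:R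
      * (z ^+ i * x * (-1) ^+ (n - k - i) * p * w * q)); first by ring.
  by rewrite e -[LHS]mulr1 -s2; ring.
rewrite (exchange_big_dep xpredT)//= big_ord_recr /= big1 => [|i _].
  rewrite add0r subnn binn expr0 !mul1r.
  rewrite (big_pred1 ord0) => [|k]; last first.
    apply/idP/eqP => [|->] /=; last by rewrite subn0.
    by have := ltn_ord k; move=> ? ?; apply: val_inj => /=; lia.
  rewrite /= !expr0 ?bin0 !mul1r mulr1 addr0 -mulrA divff ?mulr1//.
  by have := x0 0%N; rewrite addr0.
rewrite -mulr_sumr.
rewrite (eq_bigl (fun k : 'I_n.+1 => (k < (n - i).+1)%N)); last first.
  by move=> k; have := ltn_ord k; have := ltn_ord i; lia.
rewrite -(big_ord_widen n.+1 (fun k : nat => (-1) ^+ k *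
   'C(n - i, k)%:R * ((x + k%:R) ^+ (n - i) / (x + k%:R))))
   ?ltnS ?leq_subr//=.
have -> : (n - i = (n - i).-1.+1)%N by have := ltn_ord i; lia.
under eq_bigr => k _ do rewrite exprSr mulfK//.
by rewrite finite_difference_exp ?mulr0//; lia.
Qed.

(** Abel's identity at sizes [n] and [n - 1]: the factor
    [y (y + j) ^ (j - 1)] is [(y + j) ^ j - j (y + j) ^ (j - 1)]. *)
Lemma hurwitz_binomial (R : fieldType) (x y : R) (n : nat) :
  (forall k, x + k%:R != 0) -> (forall k, y + k%:R != 0) ->
  x + y + n%:R != 0 ->
  \sum_(k < n.+1) 'C(n, k)%:R * (x * ((x + k%:R) ^+ k / (x + k%:R)))
     * (y * ((y + (n - k)%:R) ^+ (n - k) / (y + (n - k)%:R)))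
  = (x + y) * ((x + y + n%:R) ^+ n / (x + y + n%:R)).
Proof.
move=> x0 y0 z0.
have eq k : y * ((y + (n - k)%:R) ^+ (n - k) / (y + (n - k)%:R)) =
    (y + (n - k)%:R) ^+ (n - k)
    - (n - k)%:R * ((y + (n - k)%:R) ^+ (n - k) / (y + (n - k)%:R)).
  apply: (canRL (addrK _)); rewrite -mulrDl mulrC divfK//.
under eq_bigr do rewrite eq mulrBr.
rewrite sumrB abel_binomial//.
case: n z0 {eq} => [|n] z0.
  rewrite big_ord_recl big_ord0 /= mul0r mulr0 !addr0 !expr0 subr0 div1r divff//.
  by move: z0; rewrite addr0.
rewrite big_ord_recr /= subnn mul0r mulr0 addr0.
rewrite (eq_bigr (fun k : 'I_n.+1 => n.+1%:R * ('C(n, k)%:R *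
    (x * ((x + k%:R) ^+ k / (x + k%:R))) * (y + 1 + (n - k)%:R) ^+ (n - k)))).
  rewrite -mulr_sumr abel_binomial//.
  have -> : x + (y + 1) + n%:R = x + y + n.+1%:R by rewrite -natr1; ring.
  rewrite exprSr mulfK// -natr1; ring.
move=> k _; have kn : (k <= n)%N by rewrite -ltnS.
rewrite subSn// exprSr mulfK; last exact: y0.
have -> : y + (n - k).+1%:R = y + 1 + (n - k)%:R by rewrite -natr1; ring.
have e : (n - k).+1%:R * 'C(n.+1, k)%:R = n.+1%:R * 'C(n, k)%:R :> R.
  by rewrite -!natrM -subSn// mul_bin_down.
by rewrite [RHS]mulrA [in RHS]mulrA -e; ring.
Qed.

(** The number of parking functions on [s] spaces, see
    [card_parking_functions]. *)
Definition park_count (s : nat) : nat := s.+1 ^ s.-1.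

Lemma park_countM (s : nat) : (park_count s * s.+1 = s.+1 ^ s)%N.
Proof. by case: s => [|s]//; rewrite /park_count /= -expnSr. Qed.

Lemma park_countE (R : numFieldType) (s : nat) :
  (park_count s)%:R = (1 + s%:R) ^+ s / (1 + s%:R) :> R.
Proof.
rewrite nat1r; apply: (canRL (mulfK _)); first by rewrite pnatr_eq0.
by rewrite -natrM park_countM natrX.
Qed.

(** Abel's identity at [x = y = 1]. Combinatorially, the last car to fill a
    block of [n + 1] spaces leaves [k] spaces on its
    left and [n - k] on its right, and has [k + 1] possible preferences. *)
Lemma park_count_rec (n : nat) :
  (\sum_(k < n.+1) 'C(n, k) * (park_count k * park_count (n - k)) * k.+1
   = park_count n.+1)%N.
Proof.
apply/eqP; rewrite -(eqr_nat rat); apply/eqP; rewrite natr_sum.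
have nz k : 1 + k%:R != 0 :> rat by rewrite nat1r pnatr_eq0.
rewrite /park_count -pred_Sn natrX -addn2 natrD.
have -> : n%:R + 2%:R = 1 + 1 + n%:R :> rat by ring.
rewrite -(abel_binomial 1 n nz) (reindex_inj rev_ord_inj) /=.
apply: eq_bigr => k _; have kn : (k <= n)%N by rewrite -ltnS.
rewrite subSS subKn// bin_sub//.
have -> : ('C(n, k) * (park_count (n - k) * park_count k) * (n - k).+1
          = 'C(n, k) * park_count k * (n - k).+1 ^ (n - k))%N.
  by rewrite -park_countM; ring.
by rewrite mul1r !natrM -park_countE natrX nat1r.
Qed.

(** For [0 < k], up to the factor [expR (- (n + k))], the Borel-Tanner
    probability that [k] independent Borel variables sum to [n + k]: the number
    [k (n + k) ^ (n - 1) / n!], written as a quotient to cover [n = 0]. *)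
Definition borel_tanner {R : fieldType} (k n : nat) : R :=
  k%:R * ((k%:R + n%:R) ^+ n / (k%:R + n%:R)) / n`!%:R.

Lemma borel_tanner_ge0 (R : numFieldType) (k n : nat) :
  0 <= borel_tanner k n :> R.
Proof. by rewrite /borel_tanner -natrD !(divr_ge0, mulr_ge0, exprn_ge0). Qed.

Lemma borel_tanner_conv (R : numFieldType) (k n : nat) :
  \sum_(j < n.+1) borel_tanner 1 j * borel_tanner k.+1 (n - j)
  = borel_tanner k.+2 n :> R.
Proof.
have nz m j : m.+1%:R + j%:R != 0 :> R by rewrite -natrD pnatr_eq0.
rewrite /borel_tanner -(addn1 k.+1) (addnC k.+1) natrD -(hurwitz_binomial (nz _) (nz _)); last first.
  by rewrite -!natrD pnatr_eq0.
rewrite mulr_suml; apply: eq_bigr => j _; have jn : (j <= n)%N by rewrite -ltnS.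
have -> : 'C(n, j)%:R = n`!%:R / (j`!%:R * (n - j)`!%:R) :> R.
  apply: (canRL (mulfK _)); last by rewrite -!natrM bin_fact.
  by rewrite -natrM pnatr_eq0 -lt0n muln_gt0 !fact_gt0.
have fnz i : i`!%:R != 0 :> R by rewrite pnatr_eq0 -lt0n fact_gt0.
move: (1 * _) (k.+1%:R * _) (fnz j) (fnz (n - j)%N) (fnz n).
by move: (j`!%:R) ((n - j)`!%:R) (n`!%:R) => *; field; apply/and3P.
Qed.

(** * Sets of occupied spaces *)

Section Occupation.
Variable n : nat.
Implicit Types (O : {set 'I_n}) (p b : 'I_n) (t : seq 'I_n).

(** A relational form of [landing] that only depends on the set of occupied
    spaces, see [landingE]. *)
Definition lands O p b :=
  [&& b \notin O, (p <= b)%N & [forall j : 'I_n, (p <= j < b)%N ==> (j \in O)]].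

Lemma lands_inj O p b b' : lands O p b -> lands O p b' -> b = b'.
Proof.
case/and3P=> bO pb /forallP allb /and3P[b'O pb' /forallP allb'].
apply: val_inj => /=; case: (ltngtP b b') => // h.
  by have := allb' b; rewrite pb h /= (negbTE bO).
by have := allb b'; rewrite pb' h /= (negbTE b'O).
Qed.

Definition occupied (occ : {ffun 'I_n -> option 'I_n}) : {set 'I_n} :=
  [set j | occ j != None].

Lemma landingE (occ : {ffun 'I_n -> option 'I_n}) p b :
  (landing occ p == Some b) = lands (occupied occ) p b.
Proof.
have sub b' : landing occ p = Some b' -> lands (occupied occ) p b'.
  rewrite /landing; case: ifPn => [op [<-]|op].
    rewrite /lands inE op leqnn /=; apply/forallP => j; lia.
  set s := [seq _ <- _ | _].
  have srt : sorted (relpre val ltn) s.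
    apply: sorted_filter => [i j k /= |]; first exact: ltn_trans.
    by rewrite -sorted_map val_enum_ord iota_ltn_sorted.
  have ms j : (j \in s) = (p < j)%N && (occ j == None).
    by rewrite mem_filter mem_enum andbT.
  case: s srt ms => // c s /= srt ms [<-{b'}].
  have /andP[pc oc] : (p < c)%N && (occ c == None) by rewrite -ms mem_head.
  rewrite /lands inE oc (ltnW pc) /=; apply/forallP => j; apply/implyP => /andP[pj jc].
  rewrite inE; apply/negP => oj.
  have pj' : (p < j)%N.
    rewrite ltn_neqAle pj andbT; apply: contraNneq op => pe.
    by rewrite (_ : p = j)//; apply: val_inj.
  have : j \in c :: s by rewrite ms pj' oj.
  rewrite in_cons => /orP[/eqP jce|js]; first by rewrite jce ltnn in jc.
  have tr : transitive (relpre (val : 'I_n -> nat) ltn).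
    by move=> x y z /=; apply: ltn_trans.
  have /allP/(_ j js) /= := order_path_min tr srt.
  by lia.
apply/eqP/idP => [/sub//|h].
case e : (landing occ p) => [b'|]; first by rewrite (lands_inj h (sub _ e)).
move: e; rewrite /landing; case: ifPn => // op.
have bs : b \in [seq j : 'I_n <- enum 'I_n | (p < j)%N & occ j == None].
  case/and3P: h => bO pb _; rewrite mem_filter mem_enum andbT.
  move: bO; rewrite inE negbK => bO; rewrite bO andbT ltn_neqAle pb andbT.
  apply: contraNneq op => pe.
  by rewrite (_ : p = b)//; apply: val_inj.
by case: [seq _ <- _ | _] bs.
Qed.

Definition add_car O p : {set 'I_n} :=
  if [pick b | lands O p b] is Some b then b |: O else O.

Lemma add_carE O p b : lands O p b -> add_car O p = b |: O.
Proof.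
move=> h; rewrite /add_car; case: pickP => [b' /(lands_inj h)->//|/(_ b)].
by rewrite h.
Qed.

(** The preferences are listed from the last car to the first one. *)
Definition occupied_by t : {set 'I_n} := foldr (fun p O => add_car O p) finset.set0 t.

Lemma card_occupied_by t : (#|occupied_by t| <= size t)%N.
Proof.
elim: t => [|p t IH] /=; first by rewrite cards0.
rewrite /add_car; case: pickP => [b _|_]; last exact: leqW.
by rewrite (leq_trans (leq_card_setU _ _)) // cards1.
Qed.

(** Only words of length [#|O|] matter, since every car must take a space. *)
Definition ways O : nat := #|[set t : #|O|.-tuple 'I_n | occupied_by t == O]%SET|.

Definition choices O b : nat := #|[set p | lands O p b]%SET|.

Lemma sum_tupleS (T : finType) (k : nat) (F : seq T -> nat) :
  (\sum_(t : k.+1.-tuple T) F t = \sum_(t : k.-tuple T) \sum_(p : T) F (p :: t))%N.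
Proof.
rewrite pair_big /= (reindex (fun tp : k.-tuple T * T => cons_tuple tp.2 tp.1))//=.
exists (fun u : k.+1.-tuple T => (behead_tuple u, thead u)) => [[u p] _|u _] /=.
  by congr pair; apply: val_inj.
by rewrite [RHS]tuple_eta; apply: val_inj.
Qed.

Lemma waysE k O : #|O| = k ->
  ways O = (\sum_(t : k.-tuple 'I_n) (occupied_by t == O))%N.
Proof.
by move=> <-; rewrite -big_mkcond sum1dep_card.
Qed.

(** At most one term is nonzero: [b] is the space taken by the arriving car,
    and there is one because [O'] is too small to be [O]. *)
Lemma add_car_eq O O' p : (#|O'| < #|O|)%N ->
  (add_car O' p == O : nat) =
  (\sum_(b in O) (O' == O :\ b) * lands (O :\ b) p b)%N.
Proof.
move=> ltOO; case: eqP => [eO|neO].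
  have [b lb] : exists b, lands O' p b.
    move: eO; rewrite /add_car; case: pickP => [b lb _|_ e]; first by exists b.
    by rewrite e ltnn in ltOO.
  have bO' : b \notin O' by case/and3P: lb.
  have eO' : O' = O :\ b by rewrite -eO (add_carE lb) setU1K.
  have bO : b \in O by rewrite -eO (add_carE lb) setU11.
  rewrite (bigD1 b)//= -eO' eqxx lb big1 ?addn0// => b' /andP[b'O b'b].
  have [eb'|//] := eqVneq O' (O :\ b').
  have : b' \in O' by rewrite eO' !inE b'b.
  by rewrite eb' !inE eqxx.
rewrite big1// => b bO; have [eO'|//] := eqVneq O' (O :\ b).
have [lb|//] := boolP (lands (O :\ b) p b).
by case: neO; rewrite eO' (add_carE lb) finset.setD1K.
Qed.

(** Sorts the words by the space that the last car takes. *)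
Lemma ways_rec O : (0 < #|O|)%N ->
  ways O = (\sum_(b in O) ways (O :\ b) * choices (O :\ b) b)%N.
Proof.
case cO : #|O| => [//|k] _.
rewrite (waysE cO) (sum_tupleS _ (fun t => occupied_by t == O : nat)) /=.
under eq_bigr => t _.
  under eq_bigr => p _.
    rewrite add_car_eq; last by rewrite cO ltnS -[leqRHS](size_tuple t) card_occupied_by.
    over.
  rewrite exchange_big /=.
  under eq_bigr => b _ do rewrite -big_distrr /= -big_mkcond sum1dep_card -/(choices _ _).
  over.
rewrite exchange_big /=; apply: eq_bigr => b bO.
rewrite -big_distrl /= -waysE//.
by move: cO; rewrite (cardsD1 b) bO add1n => -[].
Qed.

End Occupation.

(** * Blocks of occupied spaces *)

Section Blocks.
Variable n : nat.
Implicit Types (O A B : {set 'I_n}) (p b : 'I_n).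

Lemma ways0 : ways (finset.set0 : {set 'I_n}) = 1%N.
Proof.
rewrite (waysE (cards0 _)) (eq_bigr (fun=> 1%N)) => [|t _].
  by rewrite sum1_card card_tuple expn0.
by rewrite tuple0 /= eqxx.
Qed.

Lemma choices_setUl A B x b : {in A, forall i : 'I_n, (i < x)%N} ->
  {in B, forall i : 'I_n, (x < i)%N} -> (b < x)%N ->
  choices (A :|: B) b = choices A b.
Proof.
move=> Ax Bx bx; apply: eq_card => p; rewrite !inE /lands !inE.
have nB (j : 'I_n) : (j <= b)%N -> (j \in B) = false.
  by move=> jb; apply: contraTF (leq_trans jb (ltnW bx)) => /Bx; rewrite ltnNge.
rewrite nB// orbF; congr [&& _, _ & _]; apply: eq_forallb => j.
case: (boolP (p <= j < b)%N) => //= /andP[_ jb].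
by rewrite inE nB ?orbF// ltnW.
Qed.

Lemma choices_setUr A B x b : {in A, forall i : 'I_n, (i < x)%N} ->
  {in B, forall i : 'I_n, (x < i)%N} -> (x < b)%N ->
  choices (A :|: B) b = choices B b.
Proof.
move=> Ax Bx xb; apply: eq_card => p; rewrite !inE /lands !inE.
have nA (j : 'I_n) : (x <= j)%N -> (j \in A) = false.
  by move=> xj; apply: contraTF xj => /Ax; rewrite ltnNge.
rewrite nA ?(ltnW xb)//=; congr [&& _, _ & _].
apply/forallP/forallP => h j; apply/implyP => /andP[pj jb]; have := h j; rewrite pj jb /= inE.
  have xn : (x < n)%N by rewrite (ltn_trans xb).
  have [px|xp] := leqP p x.
    have := h (Ordinal xn); rewrite /= px xb inE /= nA//= => /Bx.
    by rewrite ltnn.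
  by rewrite nA// ltnW// (leq_trans xp).
by move=> ->; rewrite orbT.
Qed.

Lemma card_setU_gap A B x : {in A, forall i : 'I_n, (i < x)%N} ->
  {in B, forall i : 'I_n, (x < i)%N} -> #|A :|: B| = (#|A| + #|B|)%N.
Proof.
move=> Ax Bx; rewrite cardsU (_ : A :&: B = finset.set0) ?cards0 ?subn0//.
apply/setP => b; rewrite !inE; apply/negP => /andP[/Ax bx /Bx].
by rewrite ltnNge (ltnW bx).
Qed.

(** Cars on the two sides of a free space do not interact, so that only the
    order in which the two groups of cars interleave remains to be chosen. *)
Lemma ways_setU A B x : {in A, forall i : 'I_n, (i < x)%N} ->
  {in B, forall i : 'I_n, (x < i)%N} ->
  ways (A :|: B) = ('C(#|A| + #|B|, #|A|) * (ways A * ways B))%N.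
Proof.
move: {2}(#|A| + #|B|)%N (leqnn (#|A| + #|B|)) => k.
elim: k A B => [|k IH] A B.
  rewrite leqn0 addn_eq0 !cards_eq0 => /andP[/eqP-> /eqP->] _ _.
  by rewrite finset.set0U cards0 ways0.
move=> ABk Ax Bx.
have [->|A0] := eqVneq A finset.set0.
  by rewrite finset.set0U cards0 bin0 ways0 !mul1n.
have [->|B0] := eqVneq B finset.set0.
  by rewrite finset.setU0 cards0 addn0 binn ways0 muln1 mul1n.
have cA : (0 < #|A|)%N by rewrite card_gt0.
have cB : (0 < #|B|)%N by rewrite card_gt0.
have dAB (b : 'I_n) : b \in A -> b \in B -> False.
  by move=> /Ax bx /Bx; rewrite ltnNge (ltnW bx).
have dis : disjoint (mem A) (mem B).
  by rewrite -finset.setI_eq0; apply/eqP/setP => b; rewrite !inE; apply/negP => /andP[/dAB].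
have cAB := card_setU_gap Ax Bx.
rewrite ways_rec ?cAB ?addn_gt0 ?cA//.
rewrite (eq_bigl [predU A & B]) => [|b]; last by rewrite !inE.
rewrite bigU //=.
have pos_dec m : (0 < m)%N -> exists m', m = m'.+1 by case: m => // m' _; exists m'.
have [a ea] := pos_dec _ cA; have [c ec] := pos_dec _ cB.
rewrite (eq_bigr (fun b : 'I_n => 'C(a + c.+1, a) * ways B * (ways (A :\ b) * choices (A :\ b) b))%N); last first.
  move=> b bA; have eAb : (A :|: B) :\ b = (A :\ b) :|: B.
    apply/setP => j; rewrite !inE; have [->|//] := eqVneq j b.
    by symmetry; apply/negP => /(dAB _ bA).
  have cAb : #|A :\ b| = a by move: ea; rewrite (cardsD1 b) bA => -[].
  have Abx : {in A :\ b, forall i : 'I_n, (i < x)%N}.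
    by move=> i; rewrite !inE => /andP[_ /Ax].
  rewrite eAb (choices_setUl Abx Bx) ?Ax// IH//; last by rewrite cAb; lia.
  by rewrite cAb ec; ring.
rewrite [X in (_ + X)%N](eq_bigr (fun b : 'I_n =>
    'C(a.+1 + c, a.+1) * ways A * (ways (B :\ b) * choices (B :\ b) b))%N); last first.
  move=> b bB; have eAb : (A :|: B) :\ b = A :|: (B :\ b).
    apply/setP => j; rewrite !inE; have [->|//] := eqVneq j b.
    by rewrite /= orbF; symmetry; apply/negP => /dAB /(_ bB).
  have cBb : #|B :\ b| = c by move: ec; rewrite (cardsD1 b) bB => -[].
  have Bbx : {in B :\ b, forall i : 'I_n, (x < i)%N}.
    by move=> i; rewrite !inE => /andP[_ /Bx].
  rewrite eAb (choices_setUr Ax Bbx) ?Bx// IH//; last by rewrite cBb; lia.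
  by rewrite cBb ea; ring.
(* Pascal's rule, according to the side of the last car. *)
rewrite -!big_distrr /= -!ways_rec// ea ec (addSnnS a c) [in RHS]addSn binS.
by ring.
Qed.

Definition block (u s : nat) : {set 'I_n} := [set i : 'I_n | (u <= i < u + s)%N]%SET.

Lemma sum_block (u s : nat) (F : nat -> nat) : (u + s <= n)%N ->
  (\sum_(b in block u s) F (b - u) = \sum_(k < s) F k)%N.
Proof.
move=> usn; under eq_bigl do rewrite inE.
rewrite (eq_bigl (fun b : 'I_n => (u <= b)%N && (b < u + s)%N))//.
rewrite -(big_mkord (fun i => (u <= i)%N && (i < u + s)%N) (fun i => F (i - u)%N)).
rewrite -(big_mkord xpredT F) -(big_nat_widen 0 (u + s) n (fun i => u <= i)%N)//.
rewrite (big_cat_nat (n := u)) ?leq_addr//= big_nat_cond big_pred0 => [|i]; last by lia.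
rewrite add0n -{1}(add0n u) big_addn (addnC u) addnK.
rewrite big_nat_cond [RHS]big_nat_cond.
by apply: eq_big => [k|k _]; rewrite ?addnK//; lia.
Qed.

Lemma card_block u s : (u + s <= n)%N -> #|block u s| = s.
Proof.
by move=> usn; rewrite -sum1_card (sum_block (fun=> 1%N))// sum1_card card_ord.
Qed.

Lemma choices_block u s b : (u <= b < u + s)%N ->
  choices (block u s :\ b) b = (b - u).+1.
Proof.
move=> /andP[ub bus]; have usn := ltn_ord b.
rewrite /choices (_ : [set p | _]%SET = block u (b - u).+1) ?card_block//; first lia.
apply/setP => p; rewrite !inE /lands !inE eqxx /=; apply/andP/idP => [[pb /forallP h]|pub].
  suff : (u <= p)%N by lia.
  have [->//|pb'] := eqVneq p b.
  have := h p; rewrite leqnn /= !inE ltn_neqAle pb' pb /= => /andP[]; lia.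
split; first by lia.
apply/forallP => j; apply/implyP => /andP[pj jb]; rewrite !inE.
apply/and3P; split; [|lia|lia].
by apply: contraTneq jb => ->; rewrite ltnn.
Qed.

Lemma ways_block u s : (u + s <= n)%N -> ways (block u s) = park_count s.
Proof.
move: {2}s (leqnn s) => k; elim: k u s => [|k IH] u [|s] //.
1,2: by move=> _ _; rewrite (_ : block u 0 = finset.set0) ?ways0//; apply/setP => j; rewrite !inE; lia.
rewrite ltnS => sk usn; rewrite ways_rec ?card_block// -park_count_rec.
rewrite -(sum_block (u := u) (fun k => 'C(s, k) * (park_count k * park_count (s - k)) * k.+1)%N)//.
apply: eq_bigr => b; rewrite inE => ubs; rewrite choices_block//; congr (_ * _)%N.
have -> : block u s.+1 :\ b = block u (b - u) :|: block b.+1 (s - (b - u)).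
  apply/setP => j; rewrite !inE.
  have -> : (j != b) = (val j != val b) by [].
  by apply/idP/idP => /=; lia.
rewrite (@ways_setU _ _ b) => [|j|j]; rewrite ?inE; [|lia|lia].
rewrite !card_block; [|lia|lia].
rewrite !IH; [|lia|lia|lia|lia].
by congr ('C(_, _) * _)%N; lia.
Qed.

Lemma ways_two_gaps (x y : 'I_n) : (x < y)%N ->
  ways (~: [set x; y]%SET)
  = ('C(n - 2, x) * (park_count x * ('C(n - 2 - x, y - x.+1) *
      (park_count (y - x.+1) * park_count (n - y.+1)))))%N.
Proof.
move=> xy; have yn := ltn_ord y.
have -> : ~: [set x; y]%SET =
    block 0 x :|: (block x.+1 (y - x.+1) :|: block y.+1 (n - y.+1)).
  apply/setP => j; rewrite !inE -!val_eqE /=; have := ltn_ord j.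
  by move=> ?; apply/idP/idP; lia.
have By : {in block x.+1 (y - x.+1), forall i : 'I_n, (i < y)%N}.
  by move=> j; rewrite inE; lia.
have Cy : {in block y.+1 (n - y.+1), forall i : 'I_n, (y < i)%N}.
  by move=> j; rewrite inE; lia.
rewrite (@ways_setU _ _ x) => [|j|j]; rewrite ?inE; [|lia|lia].
rewrite (ways_setU By Cy) (card_setU_gap By Cy) !card_block; [|lia|lia|lia].
rewrite !ways_block; [|lia|lia|lia].
by congr ('C(_, _) * (_ * ('C(_, _) * _)))%N; lia.
Qed.

Lemma choices_single_gap b : choices (~: [set b]%SET) b = b.+1.
Proof.
rewrite /choices (_ : [set p | _]%SET = block 0 b.+1) ?card_block ?ltn_ord//.
apply/setP => p; rewrite !inE /lands !inE eqxx /= add0n ltnS.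
apply: andb_idr => _; apply/forallP => j; apply/implyP => /andP[_ jb].
by rewrite !inE; apply: contraTneq jb => ->; rewrite ltnn.
Qed.

Lemma choices_first_gap (a b : 'I_n) : (a < b)%N ->
  choices (~: [set a; b]%SET) a = a.+1.
Proof.
move=> ab; rewrite -[RHS]choices_single_gap; apply: eq_card => p.
rewrite !inE /lands !inE eqxx /=; congr (_ && _); apply: eq_forallb => j.
have [->|ja] := eqVneq j a; first by rewrite ltnn andbF.
have [->|jb] := eqVneq j b; first by rewrite (leq_gtF (ltnW ab)) andbF.
by rewrite !inE (negbTE ja) (negbTE jb).
Qed.

Lemma choices_second_gap (a b : 'I_n) : (b < a)%N ->
  choices (~: [set a; b]%SET) a = (a - b)%N.
Proof.
move=> ba; have an := ltn_ord a.
rewrite /choices (_ : [set p | _]%SET = block b.+1 (a - b)) ?card_block//; first by lia.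
apply/setP => p; rewrite !inE /lands !inE eqxx /=.
apply/andP/idP => [[pa /forallP h]|pba].
  suff : (b < p)%N by lia.
  rewrite ltnNge; apply/negP => pb.
  by have := h b; rewrite pb ba /= !inE eqxx orbT.
split; first by lia.
apply/forallP => j; apply/implyP => /andP[pj ja]; rewrite !inE -!val_eqE /=; lia.
Qed.

End Blocks.

(** * Counting parking functions by the spaces of the last two cars *)

Section Words.
Variable n : nat.
Implicit Types (pi : {ffun 'I_n -> 'I_n}) (occ : {ffun 'I_n -> option 'I_n}).
Implicit Types (i j p b : 'I_n) (r : seq 'I_n).

Definition park_cars pi r : {ffun 'I_n -> option 'I_n} :=
  foldr (fun i occ => park_car pi occ i) [ffun=> None] r.

Lemma parkedE pi : parked pi = park_cars pi (rev (enum 'I_n)).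
Proof. by rewrite /parked /park_cars -[enum _ in LHS]revK foldl_rev. Qed.

Lemma occupied_park_car pi occ i :
  occupied (park_car pi occ i) = add_car (occupied occ) (pi i).
Proof.
rewrite /park_car; case e : (landing occ (pi i)) => [b|].
  have l : lands (occupied occ) (pi i) b by rewrite -landingE e eqxx.
  rewrite (add_carE l).
  by apply/setP => j; rewrite !inE ffunE; case: (j == b).
rewrite /add_car; case: pickP => // b; by rewrite -landingE e.
Qed.

Lemma occupied_park_cars pi r :
  occupied (park_cars pi r) = occupied_by [seq pi i | i <- r].
Proof.
elim: r => [|i r IH] /=; last by rewrite occupied_park_car IH.
by apply/setP => j; rewrite !inE ffunE.
Qed.

Lemma park_car_neq pi occ i i' j : i' != i ->
  park_car pi occ i j = Some i' -> occ j = Some i'.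
Proof.
move=> /eqP ii'; rewrite /park_car; case: (landing _ _) => // b.
by rewrite ffunE; case: (j == b) => // -[/esym].
Qed.

Lemma park_cars_mem pi r i j : park_cars pi r j = Some i -> i \in r.
Proof.
elim: r => [|k r IH]; first by rewrite ffunE.
rewrite inE /=; have [//|ik] := eqVneq i k; by move=> /(park_car_neq ik) /IH.
Qed.

(** A car parks only on its own arrival: where car [i] ends up was decided with
    the cars [r] before it. *)
Lemma park_cars_lands pi r i j : i \notin r ->
  park_cars pi (i :: r) j = Some i -> lands (occupied (park_cars pi r)) (pi i) j.
Proof.
move=> ir; rewrite /= /park_car -landingE.
case: (landing _ _) => [b|/park_cars_mem]; last by rewrite (negbTE ir).
rewrite ffunE; have [->//|_ /park_cars_mem] := eqVneq j b.
by rewrite (negbTE ir).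
Qed.

(** If as many spaces are filled as cars arrived, no car left the street. *)
Lemma park_cars_all pi r : (size r <= #|occupied (park_cars pi r)|)%N ->
  {in r, forall i, exists j, park_cars pi r j = Some i}.
Proof.
elim: r => [|i r IH] //=.
have le_r : (#|occupied (park_cars pi r)| <= size r)%N.
  by rewrite occupied_park_cars (leq_trans (card_occupied_by _)) ?size_map.
rewrite /park_car; case e : (landing _ _) => [b|]; last by rewrite ltnNge le_r.
move=> le_ir i'; rewrite inE; have [-> _|ii' /= i'r] := eqVneq i' i.
  by exists b; rewrite ffunE eqxx.
have bO : park_cars pi r b = None.
  have /and3P[] : lands (occupied (park_cars pi r)) (pi i) b by rewrite -landingE e.
  by rewrite inE negbK => /eqP.
have [|j jr] := IH _ i' i'r; last first.
  by exists j; rewrite ffunE; have [ejb|//] := eqVneq j b; rewrite ejb bO in jr.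
move: le_ir; rewrite (_ : [ffun _ => _] = park_car pi (park_cars pi r) i); last first.
  by rewrite /park_car e.
rewrite occupied_park_car; have l : lands (occupied (park_cars pi r)) (pi i) b by rewrite -landingE e.
rewrite (add_carE l); rewrite cardsU1; case: (b \notin _) => /=; lia.
Qed.

Lemma parking_functionsE pi :
  (pi \in parking_functions n) =
  (occupied_by [seq pi i | i <- rev (enum 'I_n)] == [set: 'I_n]%SET).
Proof.
rewrite -occupied_park_cars -parkedE; apply/idP/eqP => [piP|full].
  by apply/setP => j; rewrite !inE (parking_permP piP).
rewrite inE; apply/forallP => i; apply/existsP.
have [||j jP] := @park_cars_all pi (rev (enum 'I_n)) _ i.
- by rewrite -parkedE full cardsT card_ord size_rev size_enum_ord.
- by rewrite mem_rev mem_enum.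
by exists j; rewrite parkedE jP.
Qed.

(** The preference functions, listed from the last car to the first one, are
    all the words of length [n]. *)
Lemma sum_words (F : seq 'I_n -> nat) :
  (\sum_(pi : {ffun 'I_n -> 'I_n}) F [seq pi i | i <- rev (enum 'I_n)]
   = \sum_(t : n.-tuple 'I_n) F t)%N.
Proof.
pose w (f : {ffun 'I_n -> 'I_n}) := map_tuple f (rev_tuple (ord_tuple n)).
have wE f i : tnth (w f) i = f (rev_ord i).
  rewrite tnth_map (tnth_nth i) /= nth_rev ?size_tuple ?card_ord//.
  congr (f _); apply: val_inj => /=.
  by rewrite nth_enum_ord; have := ltn_ord i; lia.
symmetry; rewrite (reindex w)//.
exists (fun t => [ffun i => tnth t (rev_ord i)]) => [f _|t _].
  by apply/ffunP => i; rewrite ffunE wE rev_ordK.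
by apply: eq_from_tnth => i; rewrite wE ffunE rev_ordK.
Qed.

Lemma card_parking_functions : #|parking_functions n| = park_count n.
Proof.
rewrite -sum1_card big_mkcond /=.
under eq_bigr => pi _ do rewrite parking_functionsE.
rewrite (sum_words (fun t => (if occupied_by t == [set: 'I_n]%SET then 1 else 0)%N)).
rewrite -(@ways_block n 0 n)// (_ : block n 0 n = [set: 'I_n]%SET); last first.
  by apply/setP => j; rewrite !inE ltn_ord.
by rewrite (@waysE _ n) ?cardsT ?card_ord//; apply: eq_bigr => t _; case: (_ == _).
Qed.

End Words.

(** Spaces are ordinals, counted from 0, whereas [car_space] counts from 1. *)
Definition last_cars_at (n : nat) (a b : 'I_n) : {set {ffun 'I_n -> 'I_n}} :=
  [set pi in parking_functions n |
    (car_space (parking_perm pi) (n - 1) == a.+1)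
    && (car_space (parking_perm pi) n == b.+1)]%SET.

Section LastCars.
Variable k : nat.
Let n := k.+2.
Let i2 : 'I_n := ord_max.
Let i1 : 'I_n := widen_ord (leqnSn k.+1) ord_max.

Lemma enum_ord_last : exists2 r : seq 'I_n,
  rev (enum 'I_n) = i2 :: i1 :: r & uniq [:: i2, i1 & r].
Proof.
pose r := rev (map (widen_ord (leqnSn k.+1)) (map (widen_ord (leqnSn k)) (enum 'I_k))).
have e : rev (enum 'I_n) = i2 :: i1 :: r.
  by rewrite enum_ordSr rev_rcons enum_ordSr map_rcons rev_rcons.
by exists r => //; rewrite -e rev_uniq enum_uniq.
Qed.

Lemma car_space_eq (s : 'S_n) (i a : 'I_n) :
  (car_space s i.+1 == a.+1) = (s a == i).
Proof.
rewrite /car_space valK /= eqSS.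
by rewrite (_ : (_ == _ :> nat) = (s^-1 i == a)%g)// -(inj_eq (@perm_inj _ s)) permKV eq_sym.
Qed.

(** All cars park as soon as the first [n - 2] fill everything but [a] and [b],
    and the last two go there. *)
Lemma last_cars_atE (a b : 'I_n) (r : seq 'I_n) pi : a != b ->
  rev (enum 'I_n) = i2 :: i1 :: r -> uniq [:: i2, i1 & r] ->
  (pi \in last_cars_at a b) =
  [&& occupied_by [seq pi i | i <- r] == ~: [set a; b]%SET,
      lands (~: [set a; b]%SET) (pi i1) a & lands (~: [set b]%SET) (pi i2) b].
Proof.
move=> ab er /= /and3P[]; rewrite inE negb_or => /andP[i21 i2r] i1r ur.
have ba : b != a by rewrite eq_sym.
have eab : a |: ~: [set a; b]%SET = ~: [set b]%SET.
  by apply/setP => j; rewrite !inE; case: eqVneq => // ->; rewrite ab.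
have eb : b |: ~: [set b]%SET = [set: 'I_n]%SET.
  by apply/setP => j; rewrite !inE; case: eqVneq.
rewrite /last_cars_at inE subn1 /= (car_space_eq _ i1) (car_space_eq _ i2).
apply/idP/idP => [/and3P[piP /eqP pa /eqP pb]|/and3P[/eqP e1 l1 l2]].
  have P j : park_cars pi [:: i2, i1 & r] j = Some (parking_perm pi j).
    by rewrite -er -parkedE parking_permP.
  have := P a; have := P b; rewrite pa pb => Pb Pa.
  have lb : lands (occupied (park_cars pi (i1 :: r))) (pi i2) b.
    by apply: park_cars_lands Pb; rewrite inE negb_or i21.
  have la : lands (occupied (park_cars pi r)) (pi i1) a.
    apply: park_cars_lands i1r _.
    by apply: park_car_neq Pa; rewrite eq_sym.
  move: piP; rewrite parking_functionsE er /= -occupied_park_cars.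
  move: la lb; rewrite /= occupied_park_car; move: (occupied _) => O la.
  rewrite (add_carE la) => lb; rewrite (add_carE lb) => /eqP/setP full.
  have bO : b \notin O.
    by case/and3P: lb => + _ _; rewrite !inE negb_or => /andP[].
  have aO : a \notin O by case/and3P: la.
  have eO : O = ~: [set a; b]%SET.
    apply/setP => j; have := full j; rewrite !inE negb_or.
    have [->|_] := eqVneq j a; first by rewrite (negbTE aO).
    by have [->|_ /= ->//] := eqVneq j b; rewrite (negbTE bO).
  by rewrite -eab -eO eqxx la.
have la : landing (park_cars pi r) (pi i1) = Some a.
  by apply/eqP; rewrite landingE occupied_park_cars e1.
have O2 : occupied (park_cars pi (i1 :: r)) = ~: [set b]%SET.
  by rewrite /= occupied_park_car occupied_park_cars e1 (add_carE l1).
have lb : landing (park_cars pi (i1 :: r)) (pi i2) = Some b.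
  by apply/eqP; rewrite landingE O2.
have piP : pi \in parking_functions n.
  rewrite parking_functionsE er -occupied_park_cars.
  by rewrite [park_cars _ _]/= occupied_park_car O2 (add_carE l2) eb.
have P j : park_cars pi [:: i2, i1 & r] j = Some (parking_perm pi j).
  by rewrite -er -parkedE parking_permP.
have := P a; have := P b; rewrite [park_cars _ _]/= {1 3}/park_car lb !ffunE eqxx (negbTE ab).
by rewrite /= /park_car la ffunE eqxx => -[<-] [<-]; rewrite piP !eqxx.
Qed.

Lemma card_last_cars_at (a b : 'I_n) : a != b ->
  #|last_cars_at a b|
  = (ways (~: [set a; b]%SET) * choices (~: [set a; b]%SET) a
     * choices (~: [set b]%SET) b)%N.
Proof.
move=> ab; have [r er ur] := enum_ord_last.
pose F (t : seq 'I_n) := if t is p2 :: p1 :: t' then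
  ([&& occupied_by t' == ~: [set a; b]%SET,
      lands (~: [set a; b]%SET) p1 a & lands (~: [set b]%SET) p2 b] : nat) else 0%N.
have card : #|~: [set a; b]%SET| = k.
  by have := cardsC [set a; b]%SET; rewrite cards2 ab card_ord; lia.
rewrite -sum1_card big_mkcond /=.
transitivity (\sum_(t : n.-tuple 'I_n) F t)%N.
  rewrite -sum_words; apply: eq_bigr => pi _.
  by rewrite (last_cars_atE _ ab er ur) er /=; case: ifP.
rewrite sum_tupleS (sum_tupleS k (fun t => \sum_p2 F (p2 :: t))%N) (waysE card).
rewrite -mulnA big_distrl /=; apply: eq_bigr => t _.
have choicesE O b' : choices O b' = (\sum_p lands O p b')%N.
  by rewrite /choices -sum1dep_card big_mkcond.
rewrite !choicesE big_distrl big_distrr /=; apply: eq_bigr => p1 _.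
by rewrite !big_distrr /=; apply: eq_bigr => p2 _; rewrite !mulnb.
Qed.

Lemma card_last_cars_at_lt (a b : 'I_n) : (a < b)%N ->
  #|last_cars_at a b|
  = ('C(k, a) * (park_count a * ('C(k - a, b - a.+1) *
      (park_count (b - a.+1) * park_count (n - b.+1)))) * a.+1 * b.+1)%N.
Proof.
move=> ab; have neq : a != b by apply: contraTneq ab => ->; rewrite ltnn.
rewrite card_last_cars_at// ways_two_gaps// choices_first_gap//.
by rewrite choices_single_gap subn2.
Qed.

Lemma card_last_cars_at_gt (a b : 'I_n) : (b < a)%N ->
  #|last_cars_at a b|
  = ('C(k, b) * (park_count b * ('C(k - b, a - b.+1) *
      (park_count (a - b.+1) * park_count (n - a.+1)))) * (a - b) * b.+1)%N.
Proof.
move=> ba; have neq : a != b by apply: contraTneq ba => ->; rewrite ltnn.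
rewrite card_last_cars_at// {1}(finset.setUC [set a]%SET) ways_two_gaps// choices_second_gap//.
by rewrite choices_single_gap subn2.
Qed.

End LastCars.

(** * Exact probabilities and the weight of a large block *)

Section ParkProbability.
Variable R : realType.

Lemma park_prob_pred (n : nat) (Q : pred 'S_n) :
  park_prob R [set s | Q s] =
  (#|[set pi in parking_functions n | Q (parking_perm pi)]%SET|%:R
    / #|parking_functions n|%:R)%:E.
Proof.
have ur : uniq [seq s <- enum 'S_n | Q s] by rewrite filter_uniq ?enum_uniq.
rewrite /park_prob (fsbigE _ _ ur); last 2 first.
- by move=> s /=; rewrite mem_filter => /andP[].
- by move=> s Qs; rewrite mem_filter mem_enum andbT Qs.
rewrite big_filter_cond (eq_bigl Q) => [|s]; last first.
  by apply/andP/idP => [[]//|Qs]; split => //; apply/mem_set.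
rewrite big_enum_cond sumEFin; congr EFin.
rewrite -mulr_suml -natr_sum; congr (_%:R / _).
rewrite -sum1_card (eq_bigl (fun pi => (pi \in parking_functions n) && Q (parking_perm pi)));
  last by move=> pi; rewrite inE.
rewrite (partition_big (@parking_perm n) Q) => [|pi /andP[]//].
apply: eq_bigr => s /= Qs; rewrite -sum1dep_card; apply: eq_bigl => pi.
rewrite -andbA; congr andb; have [->|_] := eqVneq (parking_perm pi) s.
  by rewrite andbT.
by rewrite andbF.
Qed.

Definition last_two_prob (n u v : nat) : R :=
  fine (park_prob R [set s : 'S_n | car_space s (n - 1) = u /\ car_space s n = v]).

Lemma last_two_probE (k : nat) (a b : 'I_k.+2) :
  last_two_prob k.+2 a.+1 b.+1 =
  #|last_cars_at a b|%:R / (k.+3 ^ k.+1)%:R.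
Proof.
rewrite /last_two_prob (_ : [set s | _] = [set s : 'S_k.+2 |
   (car_space s (k.+2 - 1) == a.+1) && (car_space s k.+2 == b.+1)]); last first.
  by apply/seteqP; split=> s /= => [[-> ->]|/andP[/eqP-> /eqP->]]//; rewrite !eqxx.
by rewrite park_prob_pred card_parking_functions.
Qed.

(** The coefficients of the exponential generating function of parking
    functions. *)
Definition park_egf (s : nat) : R := (park_count s)%:R / s`!%:R.

Lemma park_egfE (s : nat) : (0 < s)%N -> park_egf s.-1 = s%:R ^+ (s - 1) / s`!%:R.
Proof.
case: s => // s _; rewrite /park_egf subn1 /= park_countE factS natrM nat1r.
rewrite invfM -mulrA; congr (_ * _).
Qed.

Lemma multinomial3 (x q r : nat) :
  'C(x + q + r, x)%:R * 'C(x + q + r - x, q)%:R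
  = (x + q + r)`!%:R / (x`!%:R * q`!%:R * r`!%:R) :> R.
Proof.
have nz i : i`!%:R != 0 :> R by rewrite pnatr_eq0 -lt0n fact_gt0.
apply: (canRL (mulfK _)); first by rewrite !mulf_neq0.
rewrite -!natrM; congr (_%:R).
have -> : (x + q + r - x = q + r)%N by lia.
rewrite -addnA.
have e1 := @bin_fact (x + (q + r)) x (leq_addr _ _).
have e2 := @bin_fact (q + r) q (leq_addr _ _).
by rewrite -e1 !addKn -e2 addKn; ring.
Qed.

Lemma last_two_prob_lt (k a b : nat) : (a < b < k.+2)%N ->
  last_two_prob k.+2 a.+1 b.+1 =
  k`!%:R / (k.+3 ^ k.+1)%:R * park_egf a * park_egf (b - a.+1)
    * park_egf (k.+2 - b.+1) * a.+1%:R * b.+1%:R.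
Proof.
move=> /andP[ab bk]; have ak := ltn_trans ab bk.
rewrite (last_two_probE (Ordinal ak) (Ordinal bk)) card_last_cars_at_lt//=.
have := multinomial3 a (b - a.+1) (k.+2 - b.+1).
rewrite (_ : (a + (b - a.+1) + (k.+2 - b.+1) = k)%N); last by lia.
rewrite !natrM => M; rewrite /park_egf.
transitivity ('C(k, a)%:R * 'C(k - a, b - a.+1)%:R * ((park_count a)%:R
   * (park_count (b - a.+1))%:R * (park_count (k.+2 - b.+1))%:R
   * a.+1%:R * b.+1%:R / (k.+3 ^ k.+1)%:R) : R); first by ring.
by rewrite M !invfM; ring.
Qed.

Lemma last_two_prob_gt (k a b : nat) : (b < a < k.+2)%N ->
  last_two_prob k.+2 a.+1 b.+1 =
  k`!%:R / (k.+3 ^ k.+1)%:R * park_egf b * park_egf (a - b.+1)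
    * park_egf (k.+2 - a.+1) * (a - b)%:R * b.+1%:R.
Proof.
move=> /andP[ba ak]; have bk := ltn_trans ba ak.
rewrite (last_two_probE (Ordinal ak) (Ordinal bk)) card_last_cars_at_gt//=.
have := multinomial3 b (a - b.+1) (k.+2 - a.+1).
rewrite (_ : (b + (a - b.+1) + (k.+2 - a.+1) = k)%N); last by lia.
rewrite !natrM => M; rewrite /park_egf.
transitivity ('C(k, b)%:R * 'C(k - b, a - b.+1)%:R * ((park_count b)%:R
   * (park_count (a - b.+1))%:R * (park_count (k.+2 - a.+1))%:R
   * (a - b)%:R * b.+1%:R / (k.+3 ^ k.+1)%:R) : R); first by ring.
by rewrite M !invfM; ring.
Qed.

Lemma cvg_congr (f g : nat -> R) (l l' : R) : f =1 g -> l = l' ->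
  f @ \oo --> l -> g @ \oo --> l'.
Proof. by move=> /funext -> ->. Qed.

Lemma cvg_seqD (f g : nat -> R) (l l' : R) : f @ \oo --> l -> g @ \oo --> l' ->
  f j + g j @[j --> \oo] --> l + l'.
Proof. by move=> ? ?; exact: cvgD. Qed.

Lemma cvg_seqM (f g : nat -> R) (l l' : R) : f @ \oo --> l -> g @ \oo --> l' ->
  f j * g j @[j --> \oo] --> l * l'.
Proof. by move=> ? ?; exact: cvgM. Qed.

Lemma cvg_shift_ratio (a b : nat) :
  (j + a)%:R / (j + b).+1%:R @[j --> \oo] --> (1 : R).
Proof.
have -> : (fun j => (j + a)%:R / (j + b).+1%:R)
    = (fun j => 1 + (a%:R - b.+1%:R) * ((j + b).+1%:R)^-1 : R).
  apply/funext => j; have nz : (j + b).+1%:R != 0 :> R by rewrite pnatr_eq0.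
  apply: (mulIf nz); rewrite divfK// mulrDl mul1r -mulrA mulVf// mulr1.
  by rewrite -addnS !natrD; ring.
have h : (j + b).+1%:R^-1 @[j --> \oo] --> (0 : R).
  by have := @cvg_harmonic R; rewrite -(cvg_shiftn b).
apply: (cvg_congr _ _ (cvgD (cvg_cst (1 : R))
  (cvg_seqM (cvg_cst (a%:R - b.+1%:R : R)) h))) => //.
by rewrite mulr0 addr0.
Qed.

(** [(M / (M + c)) ^ M] lies between the exponentials of [- c] and of
    [- c M / (M + c)], by [1 + x <= expR x] used at [c / M] and at
    [- c / (M + c)]. *)
Lemma cvg_expR_ratio (c : nat) :
  (j.+1%:R / (j + c).+1%:R) ^+ j.+1 @[j --> \oo] --> (expR (- c%:R) : R).
Proof.
apply: (@squeeze_cvgr _ _ _ _ (fun=> expR (- c%:R))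
   (fun j => expR (- c%:R * (j.+1%:R / (j + c).+1%:R)))).
- apply: nearW => j.
  have p1 : 0 < j.+1%:R :> R by rewrite ltr0n.
  have p2 : 0 < (j + c).+1%:R :> R by rewrite ltr0n.
  have e2 : (j + c).+1%:R = j.+1%:R + c%:R :> R by rewrite -natrD addSn.
  apply/andP; split.
    have -> : - c%:R = (- c%:R / j.+1%:R) * j.+1%:R :> R by rewrite divfK ?gt_eqF.
    rewrite expRM_natr lerXn2r ?nnegrE ?expR_ge0 ?divr_ge0//.
    rewrite mulNr expRN -[leRHS]invrK lef_pV2 ?posrE ?expR_gt0 ?invr_gt0 ?divr_gt0//.
    by rewrite invf_div (le_trans _ (expR_ge1Dx _))// e2 mulrDl divff ?gt_eqF.
  have -> : - c%:R * (j.+1%:R / (j + c).+1%:R) = (- c%:R / (j + c).+1%:R) * j.+1%:R :> R.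
    by ring.
  rewrite expRM_natr lerXn2r ?nnegrE ?expR_ge0 ?divr_ge0//.
  rewrite (le_trans _ (expR_ge1Dx _))//.
  have -> : j.+1%:R = (j + c).+1%:R - c%:R :> R by rewrite e2 addrK.
  by rewrite mulrBl divff ?gt_eqF// mulNr.
- exact: (cvg_cst (expR (- c%:R) : R)).
- have h : - c%:R * (j.+1%:R / (j + c).+1%:R) @[j --> \oo] --> (- c%:R : R).
    apply: (cvg_congr _ _ (cvg_seqM (cvg_cst (- c%:R : R)) (cvg_shift_ratio 1 c))).
      by move=> j /=; rewrite addn1.
    by rewrite mulr1.
  exact: (@continuous_cvg _ R R _ _ _ expR _ (@continuous_expR R _) h).
Qed.

Lemma cvg_fact_ratio (c d : nat) :
  (j + d)`!%:R / (j`!%:R * (j + c).+1%:R ^+ d) @[j --> \oo] --> (1 : R).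
Proof.
elim: d => [|d IH].
  apply: (cvg_congr _ erefl (cvg_cst (1 : R))) => j.
  by rewrite addn0 expr0 mulr1 divff// pnatr_eq0 -lt0n fact_gt0.
apply: (cvg_congr _ (mulr1 _) (cvg_seqM IH (cvg_shift_ratio d.+1 c))) => j /=.
by rewrite addnS factS natrM exprSr !invfM; ring.
Qed.

(** In a street of [n = j + c] spaces, [n ^ 2] times the factor of the exact
    probability due to a block of size [j]: the other factors count the two
    remaining blocks, of total size [c - 2], and the last two preferences. *)
Definition big_block (c j : nat) : R :=
  (j + c)%:R ^+ 2 * (j + c - 2)`!%:R / ((j + c).+1 ^ (j + c - 1))%:R * park_egf j.

Lemma cvg_big_block (c : nat) : (2 <= c)%N ->
  big_block c j @[j --> \oo] --> (expR (- c%:R) : R).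
Proof.
case: c => [|[|d]]// _.
(* The factor [n ^ 2] is compared with [(j + 1) ^ 2]: one [j + 1] completes the
   power [j], the other one is the denominator of [park_count j]. *)
have r := cvg_shift_ratio d.+2 0.
apply: (cvg_congr _ _ (cvg_seqM (@cvg_expR_ratio d.+2)
  (cvg_seqM (cvg_fact_ratio d.+2 d) (cvg_seqM r r)))) => [j /=|]; last by rewrite !mulr1.
rewrite /big_block /park_egf park_countE nat1r addn0.
have -> : (j + d.+2 - 2 = j + d)%N by lia.
have -> : (j + d.+2 - 1 = j + d.+1)%N by lia.
have nz m : m.+1%:R != 0 :> R by rewrite pnatr_eq0.
have fnz m : m`!%:R != 0 :> R by rewrite pnatr_eq0 -lt0n fact_gt0.
rewrite natrX exprD expr2 (exprS _ d) exprS expr_div_n.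
move: (nz j) (nz (j + d.+2)%N) (fnz j).
move: (j.+1%:R) ((j + d.+2).+1%:R) (j`!%:R) (j + d)`!%:R => x y f F x0 y0 f0.
have := expf_neq0 d y0; have := expf_neq0 j y0; have := expf_neq0 j x0.
move: (x ^+ j) (y ^+ j) (y ^+ d) => X Y Z X0 Y0 Z0.
by field; apply/and5P.
Qed.

End ParkProbability.

(** * Asymptotics of the joint law of the last two cars *)

Section Limits.
Variable R : realType.
Local Notation egf := (@park_egf R).
Local Notation prob := (@last_two_prob R).

Lemma park_egf_neq0 (s : nat) : egf s != 0.
Proof.
by rewrite mulf_neq0 ?invr_neq0// pnatr_eq0 -lt0n ?fact_gt0// expn_gt0.
Qed.

Lemma park_egf_mul (s : nat) : (0 < s)%N ->
  egf s.-1 * s%:R = s%:R ^+ s / s`!%:R.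
Proof.
move=> s0; rewrite park_egfE// mulrAC -exprSr subn1 prednK//.
Qed.

Lemma big_blockE (k c j : nat) : k.+2 = (j + c)%N ->
  k`!%:R / (k.+3 ^ k.+1)%:R * egf j = big_block R c j / (j + c)%:R ^+ 2.
Proof.
move=> e; rewrite /big_block -e !subSS !subn0.
have : k.+2%:R != 0 :> R by rewrite pnatr_eq0.
have : (k.+3 ^ k.+1)%:R != 0 :> R by rewrite pnatr_eq0 expn_eq0.
by move: (k.+2%:R) ((k.+3 ^ k.+1)%:R) => x y x0 y0; field; apply/andP.
Qed.

(** Both spaces at a fixed distance from the right end, so that the first block
    is the large one. *)
Lemma last_two_prob_right_lt (l m j : nat) : (1 <= m < l)%N ->
  prob (j + l) (j + l + 1 - l) (j + l + 1 - m) =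
  big_block R l j * (egf (l - m).-1 * egf m.-1)
   * ((j + 1)%:R / (j + l)%:R * ((j + (l + 1 - m))%:R / (j + l)%:R)).
Proof.
move=> /andP[m0 ml]; have [k ek] : exists k, k.+2 = (j + l)%N by exists (j + l - 2)%N; lia.
have -> : (j + l + 1 - l = j.+1)%N by lia.
have -> : (j + l + 1 - m = (j + l - m).+1)%N by lia.
rewrite -{1}ek last_two_prob_lt; last by lia.
rewrite (big_blockE ek).
have -> : (j + l - m - j.+1 = (l - m).-1)%N by lia.
have -> : (k.+2 - (j + l - m).+1 = m.-1)%N by lia.
have -> : (j + (l + 1 - m) = (j + l - m).+1)%N by lia.
by rewrite addn1; field; rewrite -natrD -ek pnatr_eq0.
Qed.

Lemma last_two_prob_right_gt (l m j : nat) : (1 <= l < m)%N ->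
  prob (j + m) (j + m + 1 - l) (j + m + 1 - m) =
  big_block R m j * (egf (m - l).-1 * egf l.-1 * (m - l)%:R
    * (j + 1)%:R / (j + m)%:R ^+ 2).
Proof.
move=> /andP[l0 lm]; have [k ek] : exists k, k.+2 = (j + m)%N by exists (j + m - 2)%N; lia.
have -> : (j + m + 1 - m = j.+1)%N by lia.
have -> : (j + m + 1 - l = (j + m - l).+1)%N by lia.
rewrite -{1}ek last_two_prob_gt; last by lia.
rewrite (big_blockE ek).
have -> : (j + m - l - j.+1 = (m - l).-1)%N by lia.
have -> : (k.+2 - (j + m - l).+1 = l.-1)%N by lia.
have -> : (j + m - l - j = m - l)%N by lia.
by rewrite addn1; field; rewrite -natrD -ek pnatr_eq0.
Qed.

(** Both spaces at a fixed distance from the left end, so that the last block is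
    the large one. *)
Lemma last_two_prob_left_lt (l m j : nat) : (1 <= l < m)%N ->
  prob (j + m) l m =
  big_block R m j * (egf l.-1 * egf (m - l).-1 * l%:R * m%:R / (j + m)%:R ^+ 2).
Proof.
case: l m => [|l] [|m]// lm.
have [k ek] : exists k, k.+2 = (j + m.+1)%N by exists (j + m.+1 - 2)%N; lia.
rewrite -{1}ek last_two_prob_lt; last by lia.
have -> : (k.+2 - m.+1 = j)%N by lia.
have -> : (m - l.+1 = (m.+1 - l.+1).-1)%N by lia.
have := big_blockE ek.
set A := k`!%:R; set B := (_ ^ _)%:R => e.
transitivity (A / B * egf j * (egf l * egf (m.+1 - l.+1).-1 * l.+1%:R * m.+1%:R)).
  by ring.
by rewrite e; ring.
Qed.

Lemma last_two_prob_left_gt (l m j : nat) : (1 <= m < l)%N ->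
  prob (j + l) l m =
  big_block R l j * (egf m.-1 * egf (l - m).-1 * (l - m)%:R * m%:R / (j + l)%:R ^+ 2).
Proof.
case: l m => [|l] [|m]// lm.
have [k ek] : exists k, k.+2 = (j + l.+1)%N by exists (j + l.+1 - 2)%N; lia.
rewrite -{1}ek last_two_prob_gt; last by lia.
have -> : (k.+2 - l.+1 = j)%N by lia.
have -> : (l - m.+1 = (l.+1 - m.+1).-1)%N by lia.
have := big_blockE ek.
set A := k`!%:R; set B := (_ ^ _)%:R => e; rewrite subSS.
transitivity (A / B * egf j * (egf m * egf (l - m).-1 * (l - m)%:R * m.+1%:R)).
  by ring.
by rewrite e; ring.
Qed.

Lemma cvg_last_two_prob (l m : nat) : (1 <= m < l)%N ->
  prob n (n + 1 - l) (n + 1 - m) @[n --> \oo] -->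
  expR (- l%:R) * (egf (l - m).-1 * egf m.-1).
Proof.
move=> ml; rewrite -(cvg_shiftn l).
have [l' el] : exists l', l = l'.+1 by exists l.-1; lia.
have r := cvg_seqM (@cvg_shift_ratio R 1 l') (@cvg_shift_ratio R (l + 1 - m) l').
have B : big_block R l j @[j --> \oo] --> expR (- l%:R) by apply: cvg_big_block; lia.
apply: (cvg_congr _ _ (cvg_seqM (cvg_seqM B (cvg_cst (egf (l - m).-1 * egf m.-1))) r)).
  by move=> j /=; rewrite last_two_prob_right_lt// (_ : (j + l').+1 = j + l)%N// el addnS.
by rewrite !mulr1.
Qed.

(** [s] is what the exact formula and the claimed equivalent have in common. *)
Lemma asymp_equiv_big_block (c : nat) (f b r s : nat -> R) : (2 <= c)%N ->
  (forall j, f (j + c)%N = big_block R c j * (s j * r j)) ->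
  (forall j, b (j + c)%N = expR (- c%:R) * s j) -> (forall j, s j != 0) ->
  r @ \oo --> (1 : R) -> asymp_equiv f b.
Proof.
move=> c2 fE bE s0 r1; rewrite /asymp_equiv -(cvg_shiftn c).
have e0 : expR (- c%:R) != 0 :> R by rewrite gt_eqF ?expR_gt0.
apply: (cvg_congr _ _ (cvg_seqM (cvg_seqM (@cvg_big_block R c c2)
   (cvg_cst (expR (- c%:R))^-1)) r1)) => [j /=|].
  by rewrite fE bE; field; rewrite e0 s0.
by rewrite divff// mulr1.
Qed.

End Limits.

(** * The Borel distribution has total mass one *)

Section BorelMass.
Variable R : realType.

Lemma sum_triangle (F : nat -> nat -> R) (N : nat) :
  \sum_(n < N) \sum_(i < n.+1) F i (n - i)%N
  = \sum_(i < N) \sum_(j < N - i) F i j.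
Proof.
elim: N => [|N IH]; first by rewrite !big_ord0.
rewrite big_ord_recr /= IH.
have -> : \sum_(i < N) \sum_(j < N - i) F i j = \sum_(i < N.+1) \sum_(j < N - i) F i j.
  by rewrite big_ord_recr /= subnn big_ord0 addr0.
rewrite -big_split /=; apply: eq_bigr => i _.
by rewrite subSn ?big_ord_recr// -ltnS.
Qed.

Lemma ler_sum_ord (f : nat -> R) (m n : nat) : (forall i, 0 <= f i) -> (m <= n)%N ->
  \sum_(i < m) f i <= \sum_(i < n) f i.
Proof.
by move=> f0 /subnKC <-; rewrite big_split_ord /= lerDl sumr_ge0.
Qed.

Lemma ler_square_triangle (F : nat -> nat -> R) (K L : nat) :
  (forall i j, 0 <= F i j) ->
  \sum_(i < K) \sum_(j < L) F i j
  <= \sum_(n < K + L) \sum_(i < n.+1) F i (n - i)%N.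
Proof.
move=> F0; rewrite sum_triangle.
apply: le_trans (ler_sum_ord (f := fun i => \sum_(j < K + L - i) F i j) _ (leq_addr L K)).
  by apply: ler_sum => i _; apply: ler_sum_ord => //; have := ltn_ord i; lia.
by move=> i; rewrite sumr_ge0.
Qed.

Lemma ler_triangle_square (F : nat -> nat -> R) (N : nat) :
  (forall i j, 0 <= F i j) ->
  \sum_(n < N) \sum_(i < n.+1) F i (n - i)%N <= \sum_(i < N) \sum_(j < N) F i j.
Proof.
move=> F0; rewrite sum_triangle; apply: ler_sum => i _.
by apply: ler_sum_ord => //; rewrite leq_subr.
Qed.

(** The probability that [k + 1] independent Borel variables sum to
    [n + k + 1]. *)
Let w (k n : nat) : R := expR (- (n + k.+1)%:R) * borel_tanner k.+1 n.

Let w_ge0 k n : 0 <= w k n.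
Proof. by rewrite mulr_ge0 ?expR_ge0 ?borel_tanner_ge0. Qed.

Let w_conv k n : \sum_(j < n.+1) w 0 j * w k (n - j) = w k.+1 n.
Proof.
rewrite /w -borel_tanner_conv mulr_sumr; apply: eq_bigr => j _.
have jn : (j <= n)%N by rewrite -ltnS.
have -> : (n + k.+2 = (j + 1) + (n - j + k.+1))%N by lia.
by rewrite (natrD _ (j + 1)) opprD expRD; ring.
Qed.

Let egf_tanner s : borel_tanner 1 s = park_egf R s.
Proof. by rewrite /borel_tanner mul1r /park_egf park_countE. Qed.

Lemma borel_pmfE m : borel_pmf m.+1 = expR (- m.+1%:R) * park_egf R m.
Proof. by rewrite /borel_pmf -(park_egfE R (ltn0Sn m)). Qed.

Let borel_w m : borel_pmf m.+1 = w 0 m.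
Proof. by rewrite borel_pmfE /w egf_tanner addn1. Qed.

(** The total progeny of a critical Poisson branching process is one more than
    the sum of the progenies of the children of the root: summing the
    convolution powers of the Borel law against the Poisson weights gives the
    Borel law shifted by one. Algebraically it is the binomial theorem for
    [(M + 1) + 1]. *)
Lemma sum_borel_tanner_fact (M : nat) :
  \sum_(i < M.+1) borel_tanner i.+1 (M - i) / i.+1`!%:R = park_egf R M.+1.
Proof.
have nz m : m.+1%:R != 0 :> R by rewrite pnatr_eq0.
have fnz m : m`!%:R != 0 :> R by rewrite pnatr_eq0 -lt0n fact_gt0.
transitivity (\sum_(i < M.+1) (M.+1%:R ^+ (M - i) * 1 ^+ i *+ 'C(M, i))
   * (M.+1%:R * M`!%:R)^-1 : R).
  apply: eq_bigr => i _; have iM : (i <= M)%N by rewrite -ltnS.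
  rewrite /borel_tanner -natrD (_ : (i.+1 + (M - i) = M.+1)%N); last by lia.
  rewrite expr1n mulr1 -(mulr_natr (_ ^+ _)) factS natrM.
  have -> : M`!%:R = 'C(M, i)%:R * (i`!%:R * (M - i)`!%:R) :> R.
    by rewrite -!natrM bin_fact.
  have c0 : 'C(M, i)%:R != 0 :> R by rewrite pnatr_eq0 -lt0n bin_gt0.
  set x := M.+1%:R ^+ (M - i); set C := 'C(M, i)%:R.
  have := nz i; have := nz M; have := fnz i; have := fnz (M - i)%N; move: c0.
  rewrite -/C; move: x C (i.+1%:R) (M.+1%:R) (i`!%:R) ((M - i)`!%:R).
  by move=> x C a b c d C0 d0 c0 b0 a0; field; rewrite a0 b0 c0 d0 C0.
rewrite -mulr_suml -exprDn natr1 /park_egf /park_count /= factS natrM natrX.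
by [].
Qed.

Let S (L : nat) : R := \sum_(m < L) borel_pmf m.+1.

Let S_ge0 L : 0 <= S L.
Proof. by rewrite /S sumr_ge0// => m _; rewrite borel_w. Qed.

(* A [k.+1]-fold product of partial sums only involves convolution indices
   below [k.+1 * L], and all those below [L] (next lemma). *)
Let expr_S_le k L : S L ^+ k.+1 <= \sum_(n < k.+1 * L) w k n.
Proof.
elim: k => [|k IH]; first by rewrite mul1n expr1 /S; under eq_bigr do rewrite borel_w.
rewrite exprS (le_trans (ler_wpM2l (S_ge0 L) IH))//.
rewrite /S mulr_suml.
under eq_bigr do rewrite mulr_sumr borel_w.
rewrite mulSn; under [leRHS]eq_bigr do rewrite -w_conv.
by apply: (ler_square_triangle (F := fun i j => w 0 i * w k j)) => i j; rewrite mulr_ge0.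
Qed.

Let expr_S_ge k L : \sum_(n < L) w k n <= S L ^+ k.+1.
Proof.
elim: k => [|k IH]; first by rewrite expr1 /S; under [leRHS]eq_bigr do rewrite borel_w.
rewrite exprS (le_trans _ (ler_wpM2l (S_ge0 L) IH))//.
rewrite /S mulr_suml.
under [leRHS]eq_bigr do rewrite mulr_sumr borel_w.
under [leLHS]eq_bigr do rewrite -w_conv.
by apply: (ler_triangle_square (F := fun i j => w 0 i * w k j)) => i j; rewrite mulr_ge0.
Qed.

(* The first Borel weight is [expR (- 1)], whence the term [- 1]. *)
Let diag_sum (N : nat) :
  \sum_(M < N) \sum_(i < M.+1) w i (M - i) / i.+1`!%:R
  = expR 1 * S N.+1 - 1.
Proof.
rewrite /S big_ord_recl /= mulrDr addrAC.
have -> : expR 1 * borel_pmf 1 = 1 :> R.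
  by rewrite /borel_pmf subnn expr0 divr1 mulr1 -expRD subrr expR0.
rewrite subrr add0r mulr_sumr; apply: eq_bigr => M _ /=.
rewrite borel_pmfE mulrA -expRD /bump /= add1n -sum_borel_tanner_fact mulr_sumr.
apply: eq_bigr => i _; have iM : (i <= M)%N by rewrite -ltnS.
rewrite /w -mulrA; congr (expR _ * _).
rewrite (_ : (M - i + i.+1 = M.+1)%N); last by lia.
by rewrite -[in RHS]natr1; ring.
Qed.

Let exp_sum (x : R) N : \sum_(i < N.+1) x ^+ i / i`!%:R
  = 1 + \sum_(i < N) x ^+ i.+1 / i.+1`!%:R.
Proof. by rewrite big_ord_recl /= expr0 divr1. Qed.

(* The terms [i < K] only use [n < K * L], since [i.+1 <= K]. *)
Let exp_sum_S_le K L : \sum_(i < K.+1) S L ^+ i / i`!%:R <= expR 1 * S (K + K * L).+1.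
Proof.
rewrite exp_sum -lerBrDl -diag_sum.
apply: le_trans (ler_square_triangle _ _ (F := fun i n => w i n / i.+1`!%:R) _).
  apply: ler_sum => i _; rewrite -mulr_suml ler_wpM2r ?invr_ge0//.
  rewrite (le_trans (expr_S_le i L))// ler_sum_ord// leq_mul2r.
  by rewrite ltn_ord orbT.
by move=> i j; rewrite divr_ge0.
Qed.

Let exp_sum_S_ge N : expR 1 * S N.+1 <= \sum_(i < N.+1) S N ^+ i / i`!%:R.
Proof.
rewrite exp_sum -lerBlDl -diag_sum.
apply: le_trans (ler_triangle_square _ (F := fun i n => w i n / i.+1`!%:R) _) _.
  by move=> i j; rewrite divr_ge0.
by apply: ler_sum => i _; rewrite -mulr_suml ler_wpM2r ?invr_ge0// expr_S_ge.
Qed.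

(* By induction through [expR 1 * S N.+1 <= expR (S N)]. *)
Let S_le1 N : S N <= 1.
Proof.
elim: N => [|N IH]; first by rewrite /S big_ord0.
have e0 : 0 < expR 1 :> R by rewrite expR_gt0.
rewrite -(ler_pM2l e0) mulr1 (le_trans (exp_sum_S_ge N))//.
have le_exp : expR (S N) <= expR 1 by rewrite ler_expR.
apply: le_trans le_exp; rewrite -(big_mkord xpredT (fun i => S N ^+ i / i`!%:R)).
apply: (nondecreasing_cvgn_le (u_ := series (exp_coeff (S N)))).
  by apply: nondecreasing_series => i _ _; exact: exp_coeff_ge0.
exact: is_cvg_series_exp_coeff.
Qed.

(** The total mass [s] satisfies [expR (s - 1) <= s], while
    [1 + x < expR x] at [x = s - 1] unless [s = 1]. *)
Lemma cvg_borel_sum : \sum_(m < L) borel_pmf m.+1 @[L --> \oo] --> (1 : R).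
Proof.
have S_nd : nondecreasing_seq S.
  by move=> a b ab; apply: (ler_sum_ord (f := fun m => borel_pmf m.+1)) => // m; rewrite borel_w.
have S_cvg : cvgn S.
  apply: nondecreasing_is_cvgn => //; exists 1 => _ [L _ <-]; exact: S_le1.
pose s := limn S.
have S_le_s L : S L <= s by exact: nondecreasing_cvgn_le.
have expS_le L : expR (S L) <= expR 1 * s.
  apply: limr_le; first exact: is_cvg_series_exp_coeff.
  apply: nearW => -[|K]; first by rewrite /series /= big_geq// mulr_ge0 ?expR_ge0// (le_trans (S_ge0 0)).
  rewrite /series /= big_mkord (le_trans (exp_sum_S_le K L))//.
  by rewrite ler_wpM2l ?expR_ge0.
have exp_s : expR s <= expR 1 * s.
  have h : expR (S L) @[L --> \oo] --> expR s.
    exact: (@continuous_cvg _ R R _ _ _ expR _ (@continuous_expR R _) S_cvg).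
  by apply: (cvgr_to_le h); apply: nearW => L; exact: expS_le.
have [s1|s1] := eqVneq (s - 1) 0.
  by move/eqP: s1; rewrite subr_eq0 => /eqP <-; exact: S_cvg.
have := expR_gt1Dx s1; rewrite expRD expRN addrC subrK.
by rewrite ltNge ler_pdivrMr ?expR_gt0// mulrC exp_s.
Qed.

End BorelMass.

(** * Convergence in distribution towards an atomic law *)

Section Atoms.
Variable R : realType.

Section OneLaw.
Context d (T : measurableType d) (P : probability T R) (V : choiceType).
Variable X : T -> V.
Hypothesis mX : forall A : set V, measurable (X @^-1` A).
Let atom v : R := fine (P (X @^-1` [set v])).

Lemma integrable_bounded_comp (g : V -> R) (M : R) (A : set T) :
  (forall v, `|g v| <= M) -> measurable A ->
  P.-integrable A (EFin \o (g \o X)).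
Proof.
move=> gM mA; apply: measurable_bounded_integrable => //.
- by rewrite (le_lt_trans (probability_le1 P mA)) ?ltry.
- apply: (measurable_funS measurableT) => //.
  by move=> _ B _; rewrite setTI comp_preimage; exact: mX.
- exists M; split; first exact: num_real.
  by move=> N MN w _ /=; rewrite (le_trans (gM _)) ?ltW.
Qed.

Variables (f : V -> R) (C : R).
Hypothesis fC : forall v, `|f v| <= C.

Let intf A : measurable A -> P.-integrable A (EFin \o (f \o X)).
Proof. exact: integrable_bounded_comp. Qed.

Let sum_atoms (s : seq V) : uniq s ->
  \int[P]_(w in X @^-1` [set` s]) f (X w) = \sum_(v <- s) f v * atom v
  /\ fine (P (X @^-1` [set` s])) = \sum_(v <- s) atom v.
Proof.
elim: s => [_|v s IH /= /andP[vs us]].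
  rewrite !big_nil (_ : [set` [::]] = set0); last by apply/seteqP; split.
  by rewrite preimage_set0 Rintegral_set0 measure0.
have [If IP] := IH us.
have -> : X @^-1` [set` v :: s] = X @^-1` [set v] `|` X @^-1` [set` s].
  apply/seteqP; split=> w /=; rewrite inE.
    by case/orP => [/eqP|]; [left|right].
  by case=> [->|->]; rewrite ?eqxx ?orbT.
have dis : X @^-1` [set v] `&` X @^-1` [set` s] = set0.
  apply/seteqP; split=> w //= [->]; by rewrite (negbTE vs).
rewrite !big_cons Rintegral_setU//; last 2 first.
- by apply: intf; exact: measurableU.
- by apply/disj_setPS; rewrite dis.
rewrite If measureU// fineD ?fin_num_measure// IP; split=> //; congr (_ + _).
rewrite -Rintegral_cst//; apply: eq_Rintegral => w.
by rewrite inE /= => ->.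
Qed.

(** Outside finitely many atoms, a bounded function contributes to the
    expectation at most its bound times the remaining mass. *)
Lemma Rintegral_atoms (s : seq V) : uniq s ->
  `|\int[P]_w f (X w) - \sum_(v <- s) f v * atom v|
  <= C * (1 - \sum_(v <- s) atom v).
Proof.
move=> us; have [<- <-] := sum_atoms us.
set B := X @^-1` [set` s]; have mB : measurable B by exact: mX.
have mCB : measurable (~` B) by exact: measurableC.
rewrite -[in X in X - _](setUv B) Rintegral_setU//; last 2 first.
- by rewrite setUv; exact: intf.
- by apply/disj_setPS; rewrite setICr.
rewrite addrC addrA addNr add0r (le_trans (le_normr_Rintegral _ _))//; first exact: intf.
have -> : 1 - fine (P B) = fine (P (~` B)).
  by rewrite probability_setC// fineB ?fin_num_measure.
rewrite -Rintegral_cst//; apply: le_Rintegral => //.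
- apply: (integrable_bounded_comp (g := fun v => `|f v|) (M := C)) => // v.
  by rewrite normr_id.
- exact: (integrable_bounded_comp (g := fun=> C) (M := `|C|)).
Qed.

End OneLaw.

(** Scheffe's lemma for laws carried by atoms: if finitely many atoms carry
    almost all the mass of the limit and their masses converge, no mass can
    escape along the sequence. *)
Lemma cvg_in_distribution_atoms (V : topologicalType)
    (dn : nat -> measure_display) (Tn : forall n, measurableType (dn n))
    (Pn : forall n, probability (Tn n) R) (Xn : forall n, Tn n -> V)
    d (T : measurableType d) (P : probability T R) (X : T -> V) :
  (forall n (A : set V), measurable (Xn n @^-1` A)) ->
  (forall A : set V, measurable (X @^-1` A)) ->
  (forall e : R, 0 < e -> exists s : seq V,
    [/\ uniq s, 1 - e < \sum_(v <- s) fine (P (X @^-1` [set v])) &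
        {in s, forall v, fine (Pn n (Xn n @^-1` [set v])) @[n --> \oo]
                         --> fine (P (X @^-1` [set v]))}]) ->
  cvg_in_distribution Pn Xn P X.
Proof.
move=> mXn mX mass f _ [C0 [_ fC0]].
pose C := `|C0| + 1; have C_gt0 : 0 < C by rewrite ltr_wpDl.
have fC v : `|f v| <= C.
  by apply: fC0 => //; rewrite ltr_pwDr// ler_norm.
have EE d' (T' : measurableType d') (P' : probability T' R) (Y : T' -> V) :
    (forall A : set V, measurable (Y @^-1` A)) ->
    ('E_P'[f \o Y] = (\int[P']_w f (Y w))%:E)%E.
  move=> mY; rewrite unlock fineK//; apply: integrable_fin_num => //.
  exact: (integrable_bounded_comp P' mY fC).
rewrite EE//; under eq_fun do rewrite EE//.
apply: cvg_EFin; first by apply: nearW.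
apply/cvgrPdist_lt => e e0 /=.
have [s [us s1 scvg]] := mass (e / (4 * C)) (divr_gt0 e0 (mulr_gt0 (ltr0n _ 4) C_gt0)).
pose p v := fine (P (X @^-1` [set v])); pose q n v := fine (Pn n (Xn n @^-1` [set v])).
pose D n := \sum_(v <- s) `|p v - q n v|.
(* Four errors smaller than [e / 4] add up: the atoms of [s] contribute at most
   [C * D n], the remaining mass of [X] at most [C] times that mass, and the
   remaining mass of [Xn n] exceeds it by at most [D n]. *)
have D_lt : \forall n \near \oo, D n < e / (4 * C).
  suff D0 : D @ \oo --> (0 : R).
    apply: (cvgr_lt _ D0); exact: divr_gt0 e0 (mulr_gt0 (ltr0n _ 4) C_gt0).
  rewrite /D; elim: s scvg {us s1 D} => [|v s IH] scvg.
    by under eq_fun do rewrite big_nil; exact: cvg_cst.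
  under eq_fun do rewrite big_cons.
  have hv : `|p v - q n v| @[n --> \oo] --> (0 : R).
    rewrite -(normr0 R) -(subrr (p v)); apply: cvg_norm.
    by apply: cvgB; [exact: cvg_cst|exact: scvg (mem_head v s)].
  have hs := IH (fun u us => scvg u (mem_behead (s := v :: s) us)).
  by have := cvg_seqD hv hs; rewrite addr0.
apply: filterS D_lt => n Dn.
have h1 := Rintegral_atoms P mX fC us.
have h2 := Rintegral_atoms (Pn n) (mXn n) fC us.
have h3 : `|\sum_(v <- s) f v * p v - \sum_(v <- s) f v * q n v| <= C * D n.
  rewrite -sumrB (le_trans (ler_norm_sum _ _ _))// mulr_sumr ler_sum// => v _.
  by rewrite -mulrBr normrM ler_wpM2r.
have h4 : \sum_(v <- s) p v - \sum_(v <- s) q n v <= D n.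
  by rewrite -sumrB ler_sum// => v _; exact: ler_norm.
have Ct : C * (e / (4 * C)) = e / 4 by field; rewrite gt_eqF.
have k1 : C * (1 - \sum_(v <- s) p v) < e / 4.
  by rewrite -Ct ltr_pM2l//; move: s1; rewrite -/(p _); lra.
have k2 : C * D n < e / 4 by rewrite -Ct ltr_pM2l.
have k3 : C * (1 - \sum_(v <- s) q n v) <= C * (1 - \sum_(v <- s) p v) + C * D n.
  by rewrite -mulrDr ler_pM2l//; lra.
rewrite (le_lt_trans (ler_distD (\sum_(v <- s) f v * p v) _ _))//.
have k4 := ler_distD (\sum_(v <- s) f v * q n v) (\sum_(v <- s) f v * p v)
  (\int[Pn n]_w f (Xn n w)).
rewrite [X in _ <= _ + X]distrC in k4.
by move: h1 h2 h3 k1 k2 k3 k4; lra.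
Qed.

End Atoms.

(** * A pair of independent Borel variables *)

(** An alias of [nat * nat] carrying the discrete sigma-algebra, on which every
    function is a random variable. *)
Definition pairs : Type := (nat * nat)%type.
HB.instance Definition _ := Choice.on pairs.
HB.instance Definition _ := isPointed.Build pairs (0, 0)%N.
HB.instance Definition _ :=
  @isMeasurable.Build default_measure_display pairs
    discrete_measurable discrete_measurable0
    discrete_measurableC discrete_measurableU.

Section BorelPairs.
Variable R : realType.
Local Open Scope ereal_scope.

(* The Borel law is shifted to start at [0]. *)
Let p (i : nat) : \bar R := (borel_pmf i.+1)%:E.

Lemma borel_pmf_ge0 m : (0 <= borel_pmf m :> R)%R.
Proof. by rewrite mulr_ge0 ?expR_ge0// divr_ge0. Qed.

Let p_ge0 i : 0 <= p i.
Proof. by rewrite lee_fin borel_pmf_ge0. Qed.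

Definition borel_mass (A : set nat) : \bar R := \sum_(0 <= i <oo | i \in A) p i.

Lemma borel_massT : borel_mass setT = 1.
Proof.
apply/cvg_lim => //.
rewrite (_ : (fun n => _) = (fun n => (\sum_(i < n) borel_pmf i.+1)%:E)); last first.
  apply/funext => n; rewrite -sumEFin big_mkord; apply: eq_bigl => i.
  exact: in_setT.
apply: cvg_EFin; first exact: nearW.
exact: cvg_borel_sum.
Qed.

Definition pair_weight (x : pairs) : \bar R := p x.1 * p x.2.

Let pair_weight_ge0 x : 0 <= pair_weight x.
Proof. exact: mule_ge0. Qed.

(** The product of two Borel laws. *)
Definition borel_pair (A : set pairs) : \bar R := \esum_(x in A) pair_weight x.

Let borel_pair0 : borel_pair set0 = 0.
Proof. by rewrite /borel_pair esum_set0. Qed.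

Let borel_pair_ge0 A : 0 <= borel_pair A.
Proof. by apply: esum_ge0 => x _. Qed.

Let borel_pair_sigma_additive : semi_sigma_additive borel_pair.
Proof.
move=> F mF tF mUF; rewrite /borel_pair nneseries_sum_bigcup//.
apply: is_cvg_nneseries => n _ _; exact: esum_ge0.
Qed.

HB.instance Definition _ := isMeasure.Build _ _ _ borel_pair
  borel_pair0 borel_pair_ge0 borel_pair_sigma_additive.

Lemma borel_pairM (A B : set nat) :
  borel_pair (A `*` B) = borel_mass A * borel_mass B.
Proof.
have massE (D : set nat) (a : nat -> \bar R) : (forall i, 0 <= a i) ->
    \sum_(0 <= i <oo | i \in D) a i = \esum_(i in D) a i.
  by move=> a0; rewrite nneseries_esum// set_mem_set.
have mB0 : 0 <= borel_mass B by apply: nneseries_ge0.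
transitivity (\esum_(i in A) \esum_(j in B) (p i * p j)).
  by rewrite esum_esum// => i j _ _; exact: mule_ge0.
transitivity (\esum_(i in A) (p i * borel_mass B)).
  apply: eq_esum => i _; rewrite -massE => [|j]; last exact: mule_ge0.
  by rewrite nneseriesZl.
rewrite -massE => [|i]; last exact: mule_ge0.
have massB : borel_mass B = (fine (borel_mass B))%:E.
  rewrite fineK// ge0_fin_numE// (@le_lt_trans _ _ 1) ?ltry// -borel_massT.
  rewrite /borel_mass [leLHS]eseries_mkcond [leRHS]eseries_mkcond.
  by apply: lee_nneseries => i _; [case: ifP|rewrite in_setT; case: ifP].
rewrite massB; under eq_eseriesr do rewrite muleC.
by rewrite nneseriesZl// muleC.
Qed.

Let borel_pairT : borel_pair setT = 1.
Proof.
by rewrite -setXTT borel_pairM borel_massT mule1.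
Qed.

HB.instance Definition _ :=
  @Measure_isProbability.Build _ _ R borel_pair borel_pairT.

End BorelPairs.

(** * The last two spaces seen from the right end *)

Section BorelVariables.
Variable R : realType.

Definition pair_fst (x : pairs) : R := x.1.+1%:R.
Definition pair_snd (x : pairs) : R := x.2.+1%:R.

Let pair_fst_mfun : measurable_fun setT pair_fst. Proof. by []. Qed.
Let pair_snd_mfun : measurable_fun setT pair_snd. Proof. by []. Qed.

HB.instance Definition _ := isMeasurableFun.Build _ _ _ _ pair_fst pair_fst_mfun.
HB.instance Definition _ := isMeasurableFun.Build _ _ _ _ pair_snd pair_snd_mfun.

Let P : probability pairs R := borel_pair R.

Let succ_in (A : set R) : set nat := [set i | A i.+1%:R].

Let mass_succ_in (A : set R) : borel_mass R (succ_in A) =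
  (\sum_(1 <= m <oo) (borel_pmf m)%:E * \d_(m%:R : R) A)%E.
Proof.
rewrite -nneseries_addn => [|i]; last by rewrite mule_ge0 ?lee_fin ?borel_pmf_ge0.
rewrite /borel_mass eseries_mkcond; apply: eq_eseriesr => i _.
rewrite addn1 diracE; case: ifPn => [/set_mem iA|/negP iA].
  by rewrite mem_set// mule1.
by rewrite memNset ?mule0// => h; apply: iA; exact: mem_set.
Qed.

Let fst_preimage (A : set R) : pair_fst @^-1` A = succ_in A `*` setT.
Proof. by apply/seteqP; split => -[i j] //= []. Qed.

Let snd_preimage (A : set R) : pair_snd @^-1` A = setT `*` succ_in A.
Proof. by apply/seteqP; split => -[i j] //= []. Qed.

Lemma borel_law_fst : borel_law (P := P) pair_fst.
Proof.
move=> A _; rewrite -mass_succ_in -[LHS]/(borel_pair R _) fst_preimage.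
by rewrite borel_pairM borel_massT mule1.
Qed.

Lemma borel_law_snd : borel_law (P := P) pair_snd.
Proof.
move=> A _; rewrite -mass_succ_in -[LHS]/(borel_pair R _) snd_preimage.
by rewrite borel_pairM borel_massT mul1e.
Qed.

Lemma independent_fst_snd : independent_RV (P := P) pair_fst pair_snd.
Proof.
move=> A B _ _; rewrite fst_preimage snd_preimage /=.
rewrite [in LHS](_ : _ `&` _ = succ_in A `*` succ_in B); last first.
  by apply/seteqP; split => -[i j] /=; tauto.
by rewrite !borel_pairM !borel_massT mule1 mul1e.
Qed.

Let X (x : pairs) : R * R := (pair_fst x + pair_snd x, pair_snd x).
Let point (i j : nat) : R * R := ((i.+1 + j.+1)%:R, j.+1%:R).

Let X_preimage i j : X @^-1` [set point i j] = [set (i, j)].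
Proof.
apply/seteqP; split => -[i' j'] /=; rewrite /X /point /pair_fst /pair_snd /=.
  case=> + /eqP; rewrite eqr_nat => + /eqP[ej].
  by rewrite ej natrD => /addIr /eqP; rewrite eqr_nat => /eqP[->].
by case=> -> ->; rewrite natrD.
Qed.

Let mass_point i j : fine (P (X @^-1` [set point i j])) =
  borel_pmf i.+1 * borel_pmf j.+1.
Proof.
rewrite X_preimage -[P _]/(borel_pair R _) /borel_pair esum_set1//.
by rewrite mule_ge0// lee_fin borel_pmf_ge0.
Qed.

Let Xn (n : nat) (s : 'S_n) : R * R :=
  ((n + 1)%:R - (car_space s (n - 1))%:R, (n + 1)%:R - (car_space s n)%:R).

Let Xn_preimage n i j : (i.+1 + j.+1 <= n + 1)%N ->
  @Xn n @^-1` [set point i j] =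
  [set s : 'S_n | car_space s (n - 1) = (n + 1 - (i.+1 + j.+1))%N /\
                  car_space s n = (n + 1 - j.+1)%N].
Proof.
move=> ijn.
have E (c u : nat) : (c <= n + 1)%N -> (n + 1)%:R - u%:R = c%:R :> R <-> u = (n + 1 - c)%N.
  move=> cn; split => [/eqP|->]; last by rewrite natrB// subKr.
  by rewrite subr_eq -natrD eqr_nat => /eqP; lia.
apply/seteqP; split => s /=; rewrite /Xn /point.
  by case=> /E -> // /E -> //; lia.
by case=> /E -> // /E -> //; lia.
Qed.

Lemma cvg_last_two_spaces :
  cvg_in_distribution (fun n => park_prob R (n := n) : probability 'S_n R) (@Xn) P X.
Proof.
apply: cvg_in_distribution_atoms => [//|//|e e0].
have c := @cvg_borel_sum R; have c2 := cvg_seqM c c.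
rewrite mulr1 in c2.
have [L _ /(_ L (leqnn L)) /= Le] := cvgr_gt _ c2 (1 - e) ltac:(by rewrite ltrBlDr ltrDl).
(* A large square of atoms has mass close to [1]. *)
exists [seq point i j | i <- iota 0 L, j <- iota 0 L]; split.
- apply: allpairs_uniq; rewrite ?iota_uniq// => -[i j] [i' j'] _ _ /= [] + /eqP.
  rewrite eqr_nat => /[swap] /eqP[->] /eqP; rewrite eqr_nat => /eqP ij.
  by congr pair; lia.
- rewrite big_allpairs_dep /=.
  move: Le; rewrite -!(big_mkord xpredT (fun m => borel_pmf m.+1)) /index_iota subn0.
  rewrite big_distrl /=; congr (_ < _); apply: eq_bigr => i _.
  by rewrite big_distrr /=; apply: eq_bigr => j _; rewrite mass_point.
(* Once [n] exceeds the coordinates, the truncated subtractions are exact. *)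
move=> _ /allpairsP[[i j] [_ _ ->]] /=; rewrite mass_point.
have ml : (1 <= j.+1 < i.+1 + j.+1)%N by lia.
have := @cvg_last_two_prob R _ _ ml.
rewrite addnK /= natrD opprD expRD.
have -> : expR (- i.+1%:R) * expR (- j.+1%:R) * (park_egf R i * park_egf R j)
    = borel_pmf i.+1 * borel_pmf j.+1 by rewrite !borel_pmfE; ring.
apply: cvg_trans; apply: near_eq_cvg.
near=> n; rewrite /last_two_prob Xn_preimage//.
by near: n; exists (i.+1 + j.+1)%N => // n /= ?; lia.
Unshelve. all: by end_near. Qed.

End BorelVariables.

(** * Limit laws and decay rates for the last two cars *)

Theorem corollary8 (R : realType) :
  [/\ (* (i), 1 <= m < l *)
      forall l m : nat, (1 <= m < l)%N ->
        fine (park_prob R [set s : 'S_n | car_space s (n - 1) = (n + 1 - l)%N /\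
                                          car_space s n = (n + 1 - m)%N])
          @[n --> \oo] -->
        (l - m)%:R ^+ (l - m - 1) * m%:R ^+ (m - 1)
          / ((l - m)`!%:R * m`!%:R) * expR (- l%:R),
      (* (i), 1 <= l < m *)
      forall l m : nat, (1 <= l < m)%N ->
        asymp_equiv
          (fun n =>
            fine (park_prob R [set s : 'S_n |
                                 car_space s (n - 1) = (n + 1 - l)%N /\
                                 car_space s n = (n + 1 - m)%N]))
          (fun n =>
            (m - l)%:R ^+ (m - l) * l%:R ^+ (l - 1)
              / (l`!%:R * (m - l)`!%:R) * expR (- m%:R) * n%:R^-1),
      (* (i), convergence in distribution *)
      exists (d : measure_display) (T : measurableType d) (P : probability T R)
             (X1 X2 : {RV P >-> R}),
        [/\ borel_law X1, borel_law X2, independent_RV X1 X2 &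
            cvg_in_distribution
              (fun n => park_prob R (n := n) : probability 'S_n R)
              (fun n (s : 'S_n) =>
                 ((n + 1)%:R - (car_space s (n - 1))%:R,
                  (n + 1)%:R - (car_space s n)%:R) : R * R)
              P (fun w => (X1 w + X2 w, X2 w) : R * R)],
      (* (ii), 1 <= l < m *)
      forall l m : nat, (1 <= l < m)%N ->
        asymp_equiv
          (fun n =>
            fine (park_prob R [set s : 'S_n | car_space s (n - 1) = l /\
                                              car_space s n = m]))
          (fun n =>
            l%:R ^+ l / l`!%:R
              * ((m - l)%:R ^+ (m - l - 1) * m%:R / (m - l)`!%:R)
              * expR (- m%:R) * (n%:R ^+ 2)^-1) &
      (* (ii), 1 <= m < l *)
      forall l m : nat, (1 <= m < l)%N ->
        asymp_equiv
          (fun n =>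
            fine (park_prob R [set s : 'S_n | car_space s (n - 1) = l /\
                                              car_space s n = m]))
          (fun n =>
            m%:R ^+ m / m`!%:R
              * ((l - m)%:R ^+ (l - m) / (l - m)`!%:R)
              * expR (- l%:R) * (n%:R ^+ 2)^-1)].
Proof.
have egf0 := park_egf_neq0 R.
have nz k : (0 < k)%N -> k%:R != 0 :> R by rewrite pnatr_eq0 -lt0n.
split.
- move=> l m ml; apply: (cvg_congr _ _ (@cvg_last_two_prob R l m ml)) => //.
  by rewrite !park_egfE; [rewrite invfM; ring|lia|lia].
- move=> l m lm; apply: (@asymp_equiv_big_block R m _ _
    (fun j => (j + 1)%:R / (j + m)%:R)
    (fun j => park_egf R (m - l).-1 * park_egf R l.-1 * (m - l)%:R / (j + m)%:R)).
  + by lia.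
  + move=> j; rewrite -[LHS]/(last_two_prob R _ _ _) last_two_prob_right_gt//.
    by have := nz (j + m)%N ltac:(lia); move: (_ + _)%:R => x x0; field.
  + move=> j; rewrite [_ * park_egf R l.-1]mulrC -(mulrA (park_egf R l.-1)) park_egf_mul; last by lia.
    by rewrite park_egfE; [rewrite invfM; ring|lia].
  + move: (park_egf R) egf0 => E E0 j.
    by rewrite !mulf_neq0 ?invr_neq0 ?E0 ?nz//; lia.
  have := @cvg_shift_ratio R 1 m.-1; rewrite (_ : (fun j => _) = (fun j => (j + 1)%:R / (j + m)%:R))//.
  by apply/funext => j; rewrite -addnS prednK//; lia.
- exists _, _, (borel_pair R), (pair_fst R), (pair_snd R).
  split; [exact: borel_law_fst|exact: borel_law_snd|exact: independent_fst_snd|].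
  exact: cvg_last_two_spaces.
- move=> l m lm; apply: (@asymp_equiv_big_block R m _ _ (fun=> 1)
    (fun j => park_egf R l.-1 * park_egf R (m - l).-1 * l%:R * m%:R / (j + m)%:R ^+ 2)).
  + by lia.
  + move=> j; rewrite -[LHS]/(last_two_prob R _ _ _) last_two_prob_left_lt//.
    by rewrite mulr1.
  + move=> j; rewrite (mulrAC _ _ l%:R) park_egf_mul; last by lia.
    by rewrite park_egfE; [ring|lia].
  + move: (park_egf R) egf0 => E E0 j.
    by rewrite !mulf_neq0 ?invr_neq0 ?expf_neq0 ?E0 ?nz//; lia.
  exact: cvg_cst.
- move=> l m ml; apply: (@asymp_equiv_big_block R l _ _ (fun=> 1)
    (fun j => park_egf R m.-1 * park_egf R (l - m).-1 * (l - m)%:R * m%:R / (j + l)%:R ^+ 2)).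
  + by lia.
  + move=> j; rewrite -[LHS]/(last_two_prob R _ _ _) last_two_prob_left_gt//.
    by rewrite mulr1.
  + move=> j; rewrite -(mulrA (park_egf R m.-1)) park_egf_mul; last by lia.
    rewrite (mulrAC _ _ m%:R) park_egf_mul; last by lia.
    by ring.
  + move: (park_egf R) egf0 => E E0 j.
    by rewrite !mulf_neq0 ?invr_neq0 ?expf_neq0 ?E0 ?nz//; lia.
  exact: cvg_cst.
Qed.
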